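(* Assume $X_n\to\infty$, $\mathbb{P}$-a.s. Then for $P$-a.e. $\omega$, under $P_\omega$ the sequence $\big(U(i)=[A(i),B(i),C(i)]\big)_{i\le 0}$ is an inhomogeneous multitype branching process with immigration $$U(1)=[1,0,0]\ \text{ with probability } \frac{p_1(0)}{1-\alpha(0)-\beta(0)},$$ $$U(1)=[0,1,0]\ \text{ with probability } \frac{\gamma(0)}{1-\alpha(0)-\beta(0)},$$ $$U(1)=[0,0,1]\ \text{ with probability } \frac{p_2(0)}{1-\alpha(0)-\beta(0)},$$ and with offspring distribution given, for $i\le 0$ and integers $a,b\ge 0$, by $$P_\omega\big(U(i)=[a,b,0]\,\big|\,U(i+1)=[1,0,0]\big)=[1-\alpha(i)-\beta(i)]\binom{a+b}{a}\alpha(i)^a\beta(i)^b,$$ $$P_\omega\big(U(i)=[a,b,1]\,\big|\,U(i+1)=[0,1,0]\big)=[1-\alpha(i)-\beta(i)]\binom{a+b}{a}\alpha(i)^a\beta(i)^b,$$ $$P_\omega\big(U(i)=[a,b,0]\,\big|\,U(i+1)=[0,0,1]\big)=[1-\alpha(i)-\beta(i)]\binom{a+b}{a}\alpha(i)^a\beta(i)^b,$$ where $$\gamma(i)=q(i)\cdot P_\omega^{i-1}[(-\infty,i-1),i+1],$$ $$\alpha(i)=q(i)\cdot P_\omega^{i-1}[(-\infty,i-1),i]\cdot\frac{p_1(i-1)}{p_1(i-1)+\gamma(i-1)},$$ $$\beta(i)=q(i)\cdot P_\omega^{i-1}[(-\infty,i-1),i]\cdot\frac{\gamma(i-1)}{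p_1(i-1)+\gamma(i-1)}.$$
   Context: **The $(1,2)$-random walk in random environment.** Let $\Lambda=\{-1,1,2\}$ and let $\mathcal{M}(\Lambda)$ be the set of probability measures on $\Lambda$. An environment is an element $\omega=\{(q(\omega)_x,p_1(\omega)_x,p_2(\omega)_x):x\in\mathbb{Z}\}\in\Omega:=\mathcal{M}(\Lambda)^{\mathbb{Z}}$ (so $q(\omega)_x+p_1(\omega)_x+p_2(\omega)_x=1$). Write $q(x)=q(\omega)_x$, $p_z(x)=p_z(\omega)_x$. Let $\theta$ be the spatial shift, $(\theta\omega)_n=\omega_{n+1}$, which is invertible and measurable together with its inverse. $P$ is a probability measure on $(\Omega,\mathcal{F})$, stationary and ergodic under $\theta$. Ellipticity is assumed: there is $\varepsilon>0$ with $p_z(0)/q(0)\ge\varepsilon$, $P$-a.s., for $z\in\{1,2\}$. Given $\omega$, $\{X_n\}_{n\ge0}$ is under $P_\omega$ the time-homogeneous Markov chain on $\mathbb{Z}$ with $X_0=0$ and $P_\omega(X_{n+1}=x-1|X_n=x)=q(x)$, $P_\omega(X_{n+1}=x+z|X_n=x)=p_z(x)$, $z\in\{1,2\}$. $P_\omega^k$ is the law of the chain started at $k$ instead of $0$. $\mathbb{P}=P\otimes P_\omega$ is the annealed law: $\mathbb{P}(F\times G)=\int_F P_\omega(G)\,P(d\omega)$. **Exit probabilities.** For $k\in\mathbb{Z}$ and $j=1,2$, $P_\omega^{k}[(-\infty,k),k+j]$ is the $P_\omega^k$-probability that the walk reaches $[k+1,\infty)$ for the first time at the point $k+j$. **Ladder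 time and counts.** $T_1=\inf\{n>0:X_n>0\}$ ($T_1<\infty$ a.s. when $X_n\to\infty$). For $i\le 0$, each step of the walk from $i$ to $i-1$ before time $T_1$ is classified by the jump by which the walk first returns to $[i,\infty)$ afterwards (its ''crossing-back''); this jump is from $i-1$ to $i$, from $i-2$ to $i$, or from $i-1$ to $i+1$. $A(i)$, $B(i)$, $C(i)$ denote the numbers of steps from $i$ to $i-1$ before time $T_1$ whose crossing-back is, respectively, from $i-1$ to $i$, from $i-2$ to $i$, and from $i-1$ to $i+1$. Set $U(i)=[A(i),B(i),C(i)]$. By convention $U(1)=[1,0,0]$, $[0,1,0]$ or $[0,0,1]$ according to whether the last jump, at time $T_1$, is from $0$ to $1$, from $-1$ to $1$, or from $0$ to $2$. **Branching process terminology.** $U(1)$ is the initial (immigrant) particle; $U(i)$ is the $(-i+1)$-th generation. ''Inhomogeneous multitype branching process'' means that $(U(1),U(0),U(-1),\dots)$ is a Markov chain in which, given $U(i+1)$, $U(i)$ is the sum of independent offspring vectors of the particles of $U(i+1)$, the offspring law of a particle depending on its type and on $i$; the offspring law of a single particle of type 1, 2, 3 is the conditional law of $U(i)$ given $U(i+1)=[1,0,0],[0,1,0],[0,0,1]$ respectively. *)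

(* Defs.v *)
From HB Require Import structures.
From mathcomp Require Import all_boot all_order all_algebra.
From mathcomp Require Import all_classical all_reals all_analysis.

Set Implicit Arguments.
Unset Strict Implicit.
Unset Printing Implicit Defensive.

Import Order.TTheory GRing.Theory Num.Theory.
Import numFieldNormedType.Exports.

Local Open Scope classical_set_scope.
Local Open Scope ring_scope.

Record jump_law (R : realType) := JumpLaw {
  jq : R;
  jp1 : R;
  jp2 : R;
  jq_ge0 : 0 <= jq;
  jp1_ge0 : 0 <= jp1;
  jp2_ge0 : 0 <= jp2;
  jump_law_sum : jq + jp1 + jp2 = 1 }.

Lemma default_jump_law (R : realType) : jump_law R.
Proof. by apply: (@JumpLaw R 1 0 0); rewrite ?ler01 ?addr0. Qed.

HB.instance Definition _ (R : realType) := gen_eqMixin (jump_law R).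
HB.instance Definition _ (R : realType) := gen_choiceMixin (jump_law R).
HB.instance Definition _ (R : realType) :=
  isPointed.Build (jump_law R) (default_jump_law R).

Definition mass (R : realType) (p : jump_law R) (z : int) : R :=
  if z == -1 then jq p
  else if z == 1 then jp1 p
  else if z == 2 then jp2 p
  else 0.

(* The product sigma-algebra is generated by the coordinate weights. *)
Definition env_cylinders (R : realType) : set (set (int -> jump_law R)) :=
  [set A | exists x z, exists2 B : set R,
     measurable B & A = [set w | B (mass (w x) z)]].

Notation env R := (g_sigma_algebraType (@env_cylinders R)).

Definition q (R : realType) (w : env R) (x : int) : R := jq (w x).
Definition p1 (R : realType) (w : env R) (x : int) : R := jp1 (w x).
Definition p2 (R : realType) (w : env R) (x : int) : R := jp2 (w x).

Definition shift (R : realType) (w : env R) : env R := fun n => w (n + 1).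

Definition stationary (R : realType) (P : probability (env R) R) : Prop :=
  forall F, measurable F -> P (@shift R @^-1` F) = P F.

Definition ergodic (R : realType) (P : probability (env R) R) : Prop :=
  forall F, measurable F -> @shift R @^-1` F = F -> P F = 0%E \/ P F = 1%E.

(* The bounds [p_z(0) / q(0) >= eps] are multiplied out: [x / 0] is [0] here,
   whereas a site with [q(0) = 0] has an infinite ratio and is allowed. *)
Definition elliptic (R : realType) (P : probability (env R) R) : Prop :=
  exists2 eps : R, 0 < eps &
    {ae P, forall w, eps * q w 0 <= p1 w 0 /\ eps * q w 0 <= p2 w 0}.

HB.instance Definition _ := isPointed.Build int 0.

Definition traj_cylinders : set (set (nat -> int)) :=
  [set A | exists n k, A = [set X | X n = k]].

Notation traj := (g_sigma_algebraType traj_cylinders).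

(* The Markov property is stated as
   [mu(X_0 = x_0, ..., X_{n+1} = x_{n+1})
      = mu(X_0 = x_0, ..., X_n = x_n) * p(x_n, x_{n+1})]. *)
Definition walk_law (R : realType) (w : env R) (k : int)
    (mu : probability traj R) : Prop :=
  mu [set X | X 0%N = k] = 1%E /\
  forall (n : nat) (x : nat -> int),
    mu [set X | forall m, (m <= n.+1)%N -> X m = x m] =
    (mu [set X | forall m, (m <= n)%N -> X m = x m] *
     (mass (w (x n)) (x n.+1 - x n))%:E)%E.

(* On rectangles, [annealed P Pw (F `*` G)] is the integral over [F] of
   [Pw w 0 G]. *)
Definition annealed (R : realType) (P : probability (env R) R)
    (Pw : env R -> int -> probability traj R) (A : set (env R * traj)) : \bar R :=
  (\int[P]_w Pw w 0%R (xsection A w))%E.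

Definition tends_to_infty (R : realType) (X : traj) : Prop :=
  ((X n)%:~R : R) @[n --> \oo] --> +oo.

Definition exit_prob (R : realType) (Pw : env R -> int -> probability traj R)
    (w : env R) (k j : int) : R :=
  fine (Pw w k [set X | exists n, X n = k + j /\
                          forall m, (m < n)%N -> X m < k + 1]).

Section weights.
Variables (R : realType) (Pw : env R -> int -> probability traj R) (w : env R).

Definition gamma (i : int) : R := q w i * exit_prob Pw w (i - 1) 2.

Definition alpha (i : int) : R :=
  q w i * exit_prob Pw w (i - 1) 1 *
  (p1 w (i - 1) / (p1 w (i - 1) + gamma (i - 1))).

Definition beta (i : int) : R :=
  q w i * exit_prob Pw w (i - 1) 1 *
  (gamma (i - 1) / (p1 w (i - 1) + gamma (i - 1))).

End weights.

(* The value [0] stands for an infinite ladder time. *)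
Definition T1 (X : traj) : nat :=
  if pselect (exists n, (0 < n)%N && (0 < X n)) is left h then ex_minn h else 0%N.

(* The walk steps from [i] to [i - 1] at time [n], and the jump by which it
   first returns to [[i, oo)] afterwards goes from [a] to [b]. *)
Definition crosses_back (X : traj) (i : int) (n : nat) (a b : int) : Prop :=
  [/\ X n = i, X n.+1 = i - 1 &
    exists m, [/\ (n < m)%N, forall l, (n < l <= m)%N -> X l < i,
                  i <= X m.+1, X m = a & X m.+1 = b]].

Definition cross_count (X : traj) (i a b : int) : nat :=
  (\sum_(n < T1 X) `[< crosses_back X i n a b >])%N.

Definition vec : Type := (nat * nat * nat)%type.

Definition U (X : traj) (i : int) : vec :=
  if i == 1 then
    let jump := (X (T1 X).-1, X (T1 X)) in
    if jump == (0, 1) then (1, 0, 0)%N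
    else if jump == (-1, 1) then (0, 1, 0)%N
    else if jump == (0, 2) then (0, 0, 1)%N
    else (0, 0, 0)%N
  else (cross_count X i (i - 1) i,
        cross_count X i (i - 2) i,
        cross_count X i (i - 1) (i + 1)).

Definition pmf (R : realType) (f : vec -> R) : Prop :=
  (forall v, 0 <= f v) /\ (\esum_(v in [set: vec]) (f v)%:E = 1)%E.

(* Laws on [vec] are given by their densities: [conv f g] is the law of the sum
   of two independent vectors with laws [f] and [g]. *)
Definition conv (R : realType) (f g : vec -> R) (v : vec) : R :=
  \sum_(a < v.1.1.+1) \sum_(b < v.1.2.+1) \sum_(c < v.2.+1)
    f (nat_of_ord a, nat_of_ord b, nat_of_ord c) *
    g (v.1.1 - a, v.1.2 - b, v.2 - c)%N.

Definition convn (R : realType) (f : vec -> R) (n : nat) : vec -> R :=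
  iter n (conv f) (fun v => (v == (0, 0, 0)%N)%:R).

(* The offspring vectors of the [u.1.1] particles of type 1, [u.1.2] of type 2
   and [u.2] of type 3 are independent, with laws [f1], [f2], [f3]. *)
Definition next_gen (R : realType) (f1 f2 f3 : vec -> R) (u : vec) : vec -> R :=
  conv (convn f1 u.1.1) (conv (convn f2 u.1.2) (convn f3 u.2)).

Definition cprob (R : realType) d (T : measurableType d) (mu : probability T R)
  (A B : set T) : R := fine (mu (A `&` B)) / fine (mu B).

(* [fj n] is the offspring law of a particle of type [j] of generation [n]. *)
Definition branching_process (R : realType) d (T : measurableType d)
    (mu : probability T R) (Z : nat -> T -> vec)
    (f1 f2 f3 : nat -> vec -> R) : Prop :=
  [/\ forall n v, measurable [set t | Z n t = v],
      forall n, [/\ pmf (f1 n), pmf (f2 n) & pmf (f3 n)] &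
      forall (n : nat) (z : nat -> vec) (v : vec),
        let history := [set t | forall m, (m <= n)%N -> Z m t = z m] in
        (0 < mu history)%E ->
        cprob mu [set t | Z n.+1 t = v] history =
        next_gen (f1 n) (f2 n) (f3 n) (z n) v].

(* Main.v *)
(* Up to the ladder time, each step from [i] to [i - 1] is matched with the jump
   that crosses back, so the vectors [U(i)], [i <= 1], are the counts, by type,
   of the upward crossings of the levels [i].  The pair (position, counts so far)
   is then a Markov chain: a jump from [x] to [x + 1] completes a particle of
   type 1 at level [x + 1], and a jump from [x] to [x + 2] completes one of type 3
   at level [x + 1] and one of type 2 at level [x + 2].

   Collapsing the excursions below level [L], the walk at [L] produces a particle
   of type 1 and returns to [L] with probability [alpha L], does so with type 2
   with probability [beta L], jumps over [L] from below with probability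
   [gamma L], and otherwise jumps up directly.  Hence for every bounded function
   [F] of the counts above level [L], the two expectations
   E[F; U(L) = v]  and  E[F * K(U(L+1), v)],  with K the offspring kernel, satisfy
   the same one-step equations below level 1 and agree above it; as the walk
   reaches every level almost surely, they coincide. *)

Require Import Defs.
From HB Require Import structures.
From mathcomp Require Import all_boot all_order all_algebra.
From mathcomp Require Import all_classical all_reals all_analysis.
From mathcomp Require Import measurable_realfun zify ring lra.

Set Implicit Arguments.
Unset Strict Implicit.
Unset Printing Implicit Defensive.

Import Order.TTheory GRing.Theory Num.Theory.
Import numFieldNormedType.Exports.
Import HBNNSimple.

Local Open Scope classical_set_scope.
Local Open Scope ring_scope.

Local Notation conv := Defs.conv.
Local Notation pmf := Defs.pmf.

(** * Value functions of the walk with its crossing counts *)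

(** While the walk is at level [L], its current parent particle at level [L + 1] is unfinished and
    the type of that parent is still open, so children cannot be attached to known parents. The
    geometric law removes this obstacle. Being memoryless, it lets the unfinished parent count as a
    fresh one, so it is enough to record the parents and the children already completed. Types 1 and
    3 share a law, and the jump that completes a type 2 parent is itself its single type 3 child.

    Expectations are taken as monotone limits of finite-horizon recursions, which turns the strong
    Markov property into algebra; trajectories enter only when these limits are identified with
    probabilities. Uniqueness of bounded solutions requires reaching every level from every starting
    point, whereas transience is given for the start [0]; stationarity carries it to all sites.
    Summing the returns to [L] divides by [1 - alpha - beta]. Ellipticity keeps this positive: it
    forces [q < 1], and [alpha + beta] is at most [q]. *)

Definition add1 (v : vec) : vec := (v.1.1.+1, v.1.2, v.2).
Definition add2 (v : vec) : vec := (v.1.1, v.1.2.+1, v.2).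
Definition add3 (v : vec) : vec := (v.1.1, v.1.2, v.2.+1).
Definition vec0 : vec := (0, 0, 0)%N.

(* Counts, by level and type, of the completed crossing-back jumps. *)
Definition state : Type := int -> vec.
Definition state0 : state := fun=> vec0.

Definition up1 (x : int) (s : state) : state :=
  fun j => if j == x + 1 then add1 (s j) else s j.
Definition up2 (x : int) (s : state) : state :=
  fun j => if j == x + 1 then add3 (s j)
           else if j == x + 2 then add2 (s j) else s j.

Section value.
Variables (R : realType) (w : env R).
Implicit Types (M L x y : int) (n : nat) (s t : state) (F G H : int -> state -> R).

(* The expectation of [F (X_T) (counts at T)] on [T <= n], for [T] the entrance
   time in [[M, oo)] of the walk started at [x] with counts [s]. *)
Fixpoint value M n F x s : R :=
  if M <= x then F x s
  else if n is n'.+1 then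
    q w x * value M n' F (x - 1) s + p1 w x * value M n' F (x + 1) (up1 x s)
      + p2 w x * value M n' F (x + 2) (up2 x s)
  else 0.

Lemma qP x : [/\ 0 <= q w x, 0 <= p1 w x, 0 <= p2 w x &
  q w x + p1 w x + p2 w x = 1].
Proof.
by split; [exact: jq_ge0|exact: jp1_ge0|exact: jp2_ge0|exact: jump_law_sum].
Qed.

Lemma value_exit M n F x s : M <= x -> value M n F x s = F x s.
Proof. by case: n => /= [|n] ->. Qed.

Lemma valueS M n F x s : x < M -> value M n.+1 F x s =
    q w x * value M n F (x - 1) s + p1 w x * value M n F (x + 1) (up1 x s)
      + p2 w x * value M n F (x + 2) (up2 x s).
Proof. by rewrite ltNge => /negbTE /= ->. Qed.

(** A simulation argument: a relation on counts that both updates preserve is carried to the exit.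
    Directly or in the limit it serves for equality, agreement above a level, a lower bound on a
    count, and the trivial relation. *)
Lemma value_rel (r : state -> state -> Prop) M n F G x s t :
  (forall x s t, r s t -> r (up1 x s) (up1 x t)) ->
  (forall x s t, r s t -> r (up2 x s) (up2 x t)) ->
  (forall y s t, M <= y -> r s t -> F y s = G y t) ->
  r s t -> value M n F x s = value M n G x t.
Proof.
move=> r1 r2 FG; elim: n x s t => [|n IH] x s t rst /=.
  by case: ifP => // Mx; apply: FG.
case: ifP => [Mx|_]; first exact: FG.
by congr (_ * _ + _ * _ + _ * _); apply: IH; auto.
Qed.

Lemma value_eq M n F G x s : (forall y s, M <= y -> F y s = G y s) ->
  value M n F x s = value M n G x s.
Proof.
move=> FG; apply: (@value_rel eq) => // [? ? ? ->|? ? ? ->|? ? ? ? <-] //.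
exact: FG.
Qed.

Lemma value_lin M n F G H (a b c : R) x s :
  value M n (fun y s => a * F y s + b * G y s + c * H y s) x s =
  a * value M n F x s + b * value M n G x s + c * value M n H x s.
Proof.
elim: n x s => [|n IH] x s /=; case: ifP => // _; first by rewrite !mulr0 !addr0.
by rewrite !IH; ring.
Qed.

Lemma value_ge0 M n F x s : (forall y s, M <= y -> 0 <= F y s) ->
  0 <= value M n F x s.
Proof.
move=> F0; elim: n x s => [|n IH] x s /=; case: ifP => // Mx; try exact: F0.
have [q0 p0 p0' _] := qP x.
by rewrite !addr_ge0// mulr_ge0.
Qed.

Lemma value_le1 M n F x s : (forall y s, M <= y -> F y s <= 1) ->
  value M n F x s <= 1.
Proof.
move=> F0; elim: n x s => [|n IH] x s /=; case: ifP => // Mx; try exact: F0.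
have [q0 p0 p0' <-] := qP x.
by rewrite !lerD// -[leRHS]mulr1 ler_wpM2l.
Qed.

Lemma value_nondecreasing M F x s : (forall y s, M <= y -> 0 <= F y s) ->
  nondecreasing_seq (fun n => value M n F x s).
Proof.
move=> F0; apply/nondecreasing_seqP => n.
elim: n x s => [|n IH] x s.
  rewrite /=; case: ifP => // Mx; have [q0 p0 p0' _] := qP x.
  by rewrite !addr_ge0// mulr_ge0//; case: ifP => // ?; exact: F0.
have [Mx|xM] := lerP M x; first by rewrite !value_exit.
rewrite valueS// [leRHS]valueS//; have [q0 p0 p0' _] := qP x.
by rewrite !lerD// ler_wpM2l.
Qed.

Definition vlim M F x s : R := limn (fun n => value M n F x s).

(** The bounds concern exit positions only, where alone [value] evaluates [F]; they make the
    finite-horizon values monotone and bounded. *)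
Definition prob_valued M F := forall y s, M <= y -> 0 <= F y s <= 1.

Lemma value_cvg M F x s : prob_valued M F ->
  value M n F x s @[n --> \oo] --> vlim M F x s.
Proof.
move=> F01; apply: nondecreasing_is_cvgn.
  by apply: value_nondecreasing => y t /(F01 _ t)/andP[].
by exists 1 => _ [n _ <-]; apply: value_le1 => y t /(F01 _ t)/andP[].
Qed.

Lemma vlimE M F x s (l : R) : value M n F x s @[n --> \oo] --> l ->
  vlim M F x s = l.
Proof. by move=> h; apply: cvg_lim. Qed.

Lemma value_le_vlim M n F x s : prob_valued M F ->
  value M n F x s <= vlim M F x s.
Proof.
move=> F01; apply: nondecreasing_cvgn_le; last exact: value_cvg.
by apply: value_nondecreasing => y t /(F01 _ t)/andP[].
Qed.

Lemma vlim01 M F x s : prob_valued M F -> 0 <= vlim M F x s <= 1.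
Proof.
move=> F01; apply/andP; split.
  apply: le_trans (value_le_vlim 0 _ _ F01).
  by apply: value_ge0 => y t /(F01 _ t)/andP[].
apply: limr_le; first exact: value_cvg.
by near=> n; apply: value_le1 => y t /(F01 _ t)/andP[].
Unshelve. all: by end_near. Qed.

Lemma vlim_exit M F x s : M <= x -> vlim M F x s = F x s.
Proof.
move=> Mx; apply: vlimE; under eq_fun do rewrite value_exit//; exact: cvg_cst.
Qed.

Lemma vlim_step M F x s : prob_valued M F -> x < M -> vlim M F x s =
    q w x * vlim M F (x - 1) s + p1 w x * vlim M F (x + 1) (up1 x s)
      + p2 w x * vlim M F (x + 2) (up2 x s).
Proof.
move=> F01 xM; apply: vlimE; rewrite -cvg_shiftS.
under eq_fun do rewrite valueS//.
by apply: cvgD; first apply: cvgD; apply: cvgMr; exact: value_cvg.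
Qed.

Lemma vlim_rel (r : state -> state -> Prop) M F G x s t :
  (forall x s t, r s t -> r (up1 x s) (up1 x t)) ->
  (forall x s t, r s t -> r (up2 x s) (up2 x t)) ->
  (forall y s t, M <= y -> r s t -> F y s = G y t) ->
  r s t -> vlim M F x s = vlim M G x t.
Proof.
move=> r1 r2 FG rst; congr (limn _); apply/funext => n; exact: (@value_rel r).
Qed.

Lemma vlim_lin M F G H (a b c : R) x s :
  prob_valued M F -> prob_valued M G -> prob_valued M H ->
  vlim M (fun y s => a * F y s + b * G y s + c * H y s) x s =
  a * vlim M F x s + b * vlim M G x s + c * vlim M H x s.
Proof.
move=> F01 G01 H01; apply: vlimE; under eq_fun do rewrite value_lin.
by apply: cvgD; first apply: cvgD; apply: cvgMr; exact: value_cvg.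
Qed.

Definition hits_every_level := forall M x,
  value M n (fun _ _ => 1) x state0 @[n --> \oo] --> (1 : R).

Lemma value1_state M n x s :
  value M n (fun _ _ => 1) x s = value M n (fun _ _ => 1) x state0.
Proof. by apply: (@value_rel (fun _ _ => True)). Qed.

(** Unrolling the one-step equation [n] times leaves an error only on the paths that have not yet
    reached [M], where [G] contributes at most [C]. *)
Lemma value_harmonic_dist M n (C : R) G x s :
  0 <= C -> (forall y s, `|G y s| <= C) ->
  (forall y s, y < M -> G y s = q w y * G (y - 1) s
     + p1 w y * G (y + 1) (up1 y s) + p2 w y * G (y + 2) (up2 y s)) ->
  `|G x s - value M n G x s| <= C * (1 - value M n (fun _ _ => 1) x s).
Proof.
move=> C0 GC Gh; elim: n x s => [|n IH] x s.
  have [Mx|xM] := lerP M x; first by rewrite !value_exit// !subrr normr0 mulr0.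
  by rewrite /= !(leNgt M) xM /= !subr0 mulr1.
have [Mx|xM] := lerP M x; first by rewrite !value_exit// !subrr normr0 mulr0.
rewrite !valueS// Gh//; have [q0 p0 p0' pE] := qP x.
set a := value M n G _ _; set b := value M n G _ _; set c := value M n G _ _.
have := IH (x - 1) s; have := IH (x + 1) (up1 x s); have := IH (x + 2) (up2 x s).
rewrite -/a -/b -/c => h3 h2 h1.
have -> : forall u v z : R, q w x * u + p1 w x * v + p2 w x * z
    - (q w x * a + p1 w x * b + p2 w x * c)
  = q w x * (u - a) + p1 w x * (v - b) + p2 w x * (z - c) by move=> *; ring.
apply: le_trans (ler_normD _ _) _; apply: le_trans (lerD (ler_normD _ _) (lexx _)) _.
rewrite !normrM (ger0_norm q0) (ger0_norm p0) (ger0_norm p0').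
apply: le_trans (lerD (lerD (ler_wpM2l q0 h1) (ler_wpM2l p0 h2)) (ler_wpM2l p0' h3)) _.
rewrite -{7}pE le_eqVlt; apply/orP; left; apply/eqP; ring.
Qed.

(* Bounded functions satisfying the one-step equation below [M] are determined
   by their values above [M], since the walk almost surely gets there. *)
Lemma vlim_harmonic M (C : R) G x s : hits_every_level ->
  (forall y s, `|G y s| <= C) ->
  (forall y s, y < M -> G y s = q w y * G (y - 1) s
     + p1 w y * G (y + 1) (up1 y s) + p2 w y * G (y + 2) (up2 y s)) ->
  vlim M G x s = G x s.
Proof.
move=> tr GC Gh; apply: vlimE.
have C0 : 0 <= C by apply: le_trans (GC 0 state0).
apply/cvgrPdist_le => e e0.
have /cvgrPdist_le /(_ (e / (C + 1))) h := tr M x.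
have d0 : 0 < e / (C + 1) by rewrite divr_gt0//; lra.
near=> n.
have := value_harmonic_dist n x s C0 GC Gh.
rewrite value1_state => /le_trans; apply.
have : `|1 - value M n (fun _ _ => 1) x state0| <= e / (C + 1).
  by near: n; exact: h.
move=> /(le_trans (ler_norm _)) h1.
apply: le_trans (ler_wpM2l C0 h1) _.
rewrite mulrA ler_pdivrMr; nra.
Unshelve. all: by end_near. Qed.

End value.

(** * First entrance above a level *)

Definition agree (L : int) (s t : state) := forall j, L <= j -> s j = t j.

Lemma agree_up1 L x s t : agree L s t -> agree L (up1 x s) (up1 x t).
Proof. by move=> st j /st; rewrite /up1 => ->. Qed.

Lemma agree_up2 L x s t : agree L s t -> agree L (up2 x s) (up2 x t).
Proof. by move=> st j /st; rewrite /up2 => ->. Qed.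

Lemma agree_up1l L x s : x + 1 < L -> agree L (up1 x s) s.
Proof. by move=> xL j Lj; rewrite /up1 ifF//; lia. Qed.

Lemma agree_up2l L x s : x + 2 < L -> agree L (up2 x s) s.
Proof. by move=> xL j Lj; rewrite /up2 !ifF//; lia. Qed.

Section entrance.
Variables (R : realType) (w : env R).
Implicit Types (M L x y : int) (n : nat) (s t : state) (F G : int -> state -> R).

Definition last_type L (v : vec) : int -> state -> R := fun _ s => (s L == v)%:R.

Lemma prob_valued_nat M (b : int -> state -> bool) :
  @prob_valued R M (fun y s => (b y s)%:R).
Proof. by move=> y s _; case: (b y s); rewrite /= ?ler01 ?lexx. Qed.

(* The probability that the walk from [x] enters [[L, oo)] by a jump whose type at
   level [L] is the unit vector [v]. *)
Definition enter L (v : vec) x : R := vlim w L (last_type L v) x state0.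

Lemma value_last_type L n v x s t : s L = t L ->
  value w L n (last_type L v) x s = value w L n (last_type L v) x t.
Proof.
by move=> st; apply: (@value_rel _ _ (fun s t => s L = t L)) => //
  [y u z uz|y u z uz|y u z _ uz]; rewrite /last_type /up1 /up2 uz.
Qed.

(** Below [L] no jump touches the counts at or above [L] until the entrance jump. That jump goes
    from [L - 1] to [L], from [L - 2] to [L] or from [L - 1] to [L + 1], and its type fixes both the
    landing point and the update. *)
Lemma value_enter L n G x s : x < L ->
  (forall y s t, L <= y -> agree L s t -> G y s = G y t) ->
  value w L n G x s =
    value w L n (last_type L (add1 vec0)) x state0 * G L (up1 (L - 1) s)
  + value w L n (last_type L (add2 vec0)) x state0 * G L (up2 (L - 2) s)
  + value w L n (last_type L (add3 vec0)) x state0 * G (L + 1) (up2 (L - 1) s).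
Proof.
move=> + GL; elim: n x s => [|n IH] x s xL.
  by rewrite /= leNgt xL !mul0r !addr0.
rewrite !valueS//.
have [x1|x1] := ltrP (x + 1) L; last first.
  have -> : x = L - 1 by lia.
  have -> : L - 1 + 2 = L + 1 by lia.
  rewrite subrK !(@value_exit _ _ L _ _ L)// !(@value_exit _ _ L _ _ (L + 1)) ?lerDl//.
  rewrite IH; last by lia.
  by rewrite /last_type /up1 /up2 /= subrK eqxx /=; ring.
have E1 v : value w L n (last_type L v) (x + 1) (up1 x state0) =
    value w L n (last_type L v) (x + 1) state0.
  by apply: value_last_type; apply: (@agree_up1l L).
have x0 : x - 1 < L by lia.
rewrite !E1 (IH _ _ x0) (IH _ _ x1).
have -> : G L (up1 (L - 1) (up1 x s)) = G L (up1 (L - 1) s).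
  by apply: GL => //; apply/agree_up1/agree_up1l.
have -> : G L (up2 (L - 2) (up1 x s)) = G L (up2 (L - 2) s).
  by apply: GL => //; apply/agree_up2/agree_up1l.
have -> : G (L + 1) (up2 (L - 1) (up1 x s)) = G (L + 1) (up2 (L - 1) s).
  by apply: GL => //; [lia|]; apply/agree_up2/agree_up1l.
have [x2|x2] := ltrP (x + 2) L; last first.
  have -> : x = L - 2 by lia.
  have -> : L - 2 + 1 = L - 1 by lia.
  rewrite subrK !(@value_exit _ _ L _ _ L)//.
  rewrite /last_type /up2 subrK eqxx.
  have -> : (L == L - 2 + 1) = false by lia.
  by rewrite /state0 /=; ring.
have E2 v : value w L n (last_type L v) (x + 2) (up2 x state0) =
    value w L n (last_type L v) (x + 2) state0.
  by apply: value_last_type; apply: (@agree_up2l L).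
rewrite !E2 IH//.
have -> : G L (up1 (L - 1) (up2 x s)) = G L (up1 (L - 1) s).
  by apply: GL => //; apply/agree_up1/agree_up2l.
have -> : G L (up2 (L - 2) (up2 x s)) = G L (up2 (L - 2) s).
  by apply: GL => //; apply/agree_up2/agree_up2l.
have -> : G (L + 1) (up2 (L - 1) (up2 x s)) = G (L + 1) (up2 (L - 1) s).
  by apply: GL => //; [lia|]; apply/agree_up2/agree_up2l.
ring.
Qed.

(* Strong Markov property at the first entrance to [[L, oo)]. *)
Lemma vlim_enter L G x s : x < L ->
  (forall y s t, L <= y -> agree L s t -> G y s = G y t) ->
  vlim w L G x s = enter L (add1 vec0) x * G L (up1 (L - 1) s)
  + enter L (add2 vec0) x * G L (up2 (L - 2) s)
  + enter L (add3 vec0) x * G (L + 1) (up2 (L - 1) s).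
Proof.
move=> xL GL; apply: vlimE; under eq_fun do rewrite value_enter//.
by apply: cvgD; first apply: cvgD; apply: cvgMl; apply: value_cvg;
  apply: prob_valued_nat.
Qed.

Lemma enter01 L v x : 0 <= enter L v x <= 1.
Proof. by apply: vlim01; apply: prob_valued_nat. Qed.

Hypothesis tr : hits_every_level w.

Lemma enter_sum L x : x < L ->
  enter L (add1 vec0) x + enter L (add2 vec0) x + enter L (add3 vec0) x = 1.
Proof.
move=> xL; rewrite -[RHS](vlimE (tr L x)) (@vlim_enter L)// !mulr1//.
Qed.

(** Tower property: the inner limit is bounded and solves the one-step equation below [M], hence
    below the lower level [L]. *)
Lemma vlim_vlim L M F x s : L <= M -> prob_valued M F ->
  vlim w L (vlim w M F) x s = vlim w M F x s.
Proof.
move=> LM F01.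
apply: (@vlim_harmonic _ _ _ 1) => // [y t|y t yL].
  by have /andP[v0 v1] := vlim01 w y t F01; rewrite ger0_norm.
by apply: vlim_step => //; apply: lt_le_trans LM.
Qed.

End entrance.


(** * Convolution and the offspring kernel *)

Section convolution.
Variable R : realType.
Implicit Types (f g h : vec -> R) (v b u : vec).

Definition dirac0 : vec -> R := fun v => (v == vec0)%:R.

Definition sh1 f : vec -> R :=
  fun v => if v.1.1 is a.+1 then f (a, v.1.2, v.2) else 0.
Definition sh2 f : vec -> R :=
  fun v => if v.1.2 is b.+1 then f (v.1.1, b, v.2) else 0.
Definition sh3 f : vec -> R :=
  fun v => if v.2 is c.+1 then f (v.1.1, v.1.2, c) else 0.

(* On each box of [vec], convolution is multiplication of trivariate polynomials;
   associativity and commutativity are inherited from there. *)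
Definition coef3 (p : {poly {poly {poly R}}}) : vec -> R :=
  fun v => p`_v.1.1`_v.1.2`_v.2.

Lemma conv_coef3 p p' : conv (coef3 p) (coef3 p') = coef3 (p * p').
Proof.
apply/funext => -[[a b] c]; rewrite /conv /coef3 /= coefM !coef_sum.
apply: eq_bigr => i _; rewrite coefM coef_sum.
by apply: eq_bigr => j _; rewrite coefM; apply: eq_bigr.
Qed.

Definition vle v u := [&& v.1.1 <= u.1.1, v.1.2 <= u.1.2 & v.2 <= u.2]%N.

Lemma eq_conv f f' g g' v :
  (forall u, vle u v -> f u = f' u) -> (forall u, vle u v -> g u = g' u) ->
  conv f g v = conv f' g' v.
Proof.
move=> ff gg; apply: eq_bigr => i _; apply: eq_bigr => j _; apply: eq_bigr => k _.
rewrite ff ?gg// /vle /= ?leq_subr//.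
by rewrite (leq_ord i) (leq_ord j) (leq_ord k).
Qed.

Definition box_poly N f : {poly {poly {poly R}}} :=
  \poly_(i < N) \poly_(j < N) \poly_(k < N) f (i, j, k).

Lemma coef3_box N f v : (maxn v.1.1 (maxn v.1.2 v.2) < N)%N ->
  coef3 (box_poly N f) v = f v.
Proof.
case: v => -[a b] c /=; rewrite !gtn_max => /and3P[aN bN cN].
by rewrite /coef3 /box_poly /= coef_poly aN coef_poly bN coef_poly cN.
Qed.

Lemma coef3_box_le f v u : vle u v ->
  f u = coef3 (box_poly (maxn v.1.1 (maxn v.1.2 v.2)).+1 f) u.
Proof.
by case: u => -[a b] c /and3P[/= h1 h2 h3]; rewrite coef3_box//= ltnS; lia.
Qed.

Lemma vle_trans u v v' : vle u v -> vle v v' -> vle u v'.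
Proof.
by rewrite /vle => /and3P[? ? ?] /and3P[? ? ?]; apply/and3P; split; lia.
Qed.

Lemma convC f g : conv f g = conv g f.
Proof.
apply/funext => v.
rewrite (@eq_conv _ _ _ _ v (@coef3_box_le f v) (@coef3_box_le g v)).
rewrite [RHS](@eq_conv _ _ _ _ v (@coef3_box_le g v) (@coef3_box_le f v)).
by rewrite !conv_coef3 mulrC.
Qed.

Lemma convA f g h : conv f (conv g h) = conv (conv f g) h.
Proof.
apply/funext => v; set B := fun f => coef3 (box_poly (maxn v.1.1 (maxn v.1.2 v.2)).+1 f).
have BE f' u : vle u v -> f' u = B f' u by exact: coef3_box_le.
rewrite (@eq_conv _ (B f) _ (conv (B g) (B h)) v (BE f)); last first.
  by move=> u uv; apply: eq_conv => t /vle_trans/(_ uv); exact: BE.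
rewrite [RHS](@eq_conv _ (conv (B f) (B g)) _ (B h) v _ (BE h)); last first.
  by move=> u uv; apply: eq_conv => t /vle_trans/(_ uv); exact: BE.
by rewrite !conv_coef3 mulrA.
Qed.

Lemma convCA f g h : conv f (conv g h) = conv g (conv f h).
Proof. by rewrite !convA (convC f). Qed.

Lemma conv0l g : conv dirac0 g = g.
Proof.
apply/funext => -[[a b] c]; rewrite /conv /=.
rewrite big_ord_recl [X in _ + X]big1 => [|i _]; last first.
  by apply: big1 => j _; apply: big1 => k _; rewrite mul0r.
rewrite addr0 big_ord_recl [X in _ + X]big1 => [|j _]; last first.
  by apply: big1 => k _; rewrite mul0r.
rewrite addr0 big_ord_recl [X in _ + X]big1 => [|k _]; last by rewrite mul0r.
by rewrite /dirac0 eqxx mul1r addr0 !subn0.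
Qed.

Lemma convDl f g h (a b : R) :
  conv (fun v => a * f v + b * g v) h = fun v => a * conv f h v + b * conv g h v.
Proof.
apply/funext => v; rewrite /conv !mulr_sumr -big_split /=; apply: eq_bigr => i _.
rewrite !mulr_sumr -big_split /=; apply: eq_bigr => j _.
by rewrite !mulr_sumr -big_split /=; apply: eq_bigr => k _; ring.
Qed.

Lemma conv_sh1 f g : conv (sh1 f) g = sh1 (conv f g).
Proof.
apply/funext => -[[a b] c]; rewrite /conv /sh1 /=; case: a => [|a].
  by rewrite big_ord1; apply: big1 => j _; apply: big1 => k _; rewrite mul0r.
rewrite big_ord_recl /= big1 ?add0r//.
by move=> j _; apply: big1 => k _; rewrite mul0r.
Qed.

Lemma conv_sh2 f g : conv (sh2 f) g = sh2 (conv f g).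
Proof.
apply/funext => -[[a b] c]; rewrite /conv /sh2 /=; case: b => [|b].
  by apply: big1 => j _; rewrite big_ord1; apply: big1 => k _; rewrite mul0r.
apply: eq_bigr => i _; rewrite big_ord_recl /= big1 ?add0r//.
by move=> j _; rewrite mul0r.
Qed.

Lemma conv_sh3 f g : conv (sh3 f) g = sh3 (conv f g).
Proof.
apply/funext => -[[a b] c]; rewrite /conv /sh3 /=; case: c => [|c].
  by apply: big1 => j _; apply: big1 => k _; rewrite big_ord1 mul0r.
apply: eq_bigr => i _; apply: eq_bigr => j _.
by rewrite big_ord_recl /= mul0r add0r.
Qed.

(** The law of [b] plus a random vector with law [f]. *)
Definition shv b f : vec -> R := fun v =>
  if vle b v then f (v.1.1 - b.1.1, v.1.2 - b.1.2, v.2 - b.2)%N else 0.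

Lemma shv1 b f : shv (add1 b) f = shv b (sh1 f).
Proof.
apply/funext => -[[x y] z]; case: b => -[a b] c; rewrite /shv /sh1 /vle /=.
case E: (x - a)%N => [|k]; first by rewrite if_same ifF//; lia.
have -> : (x - a.+1 = k)%N by lia.
by have -> : (a < x)%N = (a <= x)%N by lia.
Qed.

Lemma shv2 b f : shv (add2 b) f = shv b (sh2 f).
Proof.
apply/funext => -[[x y] z]; case: b => -[a b] c; rewrite /shv /sh2 /vle /=.
case E: (y - b)%N => [|k]; first by rewrite if_same ifF//; lia.
have -> : (y - b.+1 = k)%N by lia.
by have -> : (b < y)%N = (b <= y)%N by lia.
Qed.

Lemma shv3 b f : shv (add3 b) f = shv b (sh3 f).
Proof.
apply/funext => -[[x y] z]; case: b => -[a b] c; rewrite /shv /sh3 /vle /=.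
case E: (z - c)%N => [|k]; first by rewrite if_same ifF//; lia.
have -> : (z - c.+1 = k)%N by lia.
by have -> : (c < z)%N = (c <= z)%N by lia.
Qed.

Lemma shv0 f : shv vec0 f = f.
Proof. by apply/funext => -[[x y] z]; rewrite /shv /= !subn0. Qed.

Lemma shv_dirac0 b : shv b dirac0 = fun v => (b == v)%:R.
Proof.
apply/funext => -[[x y] z]; case: b => -[a b] c; rewrite /shv /dirac0 /vle /=.
rewrite !xpair_eqE; case: ifP => h; first by congr (nat_of_bool _)%:R; lia.
by rewrite (_ : _ && _ = false)//; lia.
Qed.

Lemma shvD b f g (x y : R) v :
  shv b (fun v => x * f v + y * g v) v = x * shv b f v + y * shv b g v.
Proof. by rewrite /shv; case: ifP => //; rewrite !mulr0 addr0. Qed.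

End convolution.

(** * The geometric offspring law and its one-child recursion *)

Section geometric.
Variables (R : realType) (a b : R).

(* The offspring law of particles of types 1 and 3; type 2 has one more particle
   of type 3 among its children. *)
Definition geom13 : vec -> R := fun v =>
  if v.2 == 0%N then (1 - a - b) * 'C(v.1.1 + v.1.2, v.1.1)%:R * a ^+ v.1.1 * b ^+ v.1.2
  else 0.
Definition geom2 : vec -> R := sh3 geom13.

Definition offspring (u : vec) : vec -> R := next_gen geom13 geom2 geom13 u.

(** Pascal's rule, read as a case distinction on the first child: type 1, type 2, or none. The
    factor [1] gives the nested sum the shape to which [convDl] applies twice. *)
Lemma geom13_rec : geom13 = fun v => 1 * (a * sh1 geom13 v + b * sh2 geom13 v)
  + (1 - a - b) * dirac0 R v.
Proof.
apply/funext => -[[x y] [|z]]; rewrite /geom13 /sh1 /sh2 /dirac0 /= !xpair_eqE /=;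
  last by rewrite andbF /=; case: x => [|x]; case: y => [|y] /=; ring.
rewrite andbT; case: x => [|x]; case: y => [|y] /=.
- by rewrite bin0; ring.
- by rewrite !add0n !bin0 exprS; ring.
- by rewrite !addn0 !binn exprS; ring.
- have E : (x.+1 + y = x + y.+1)%N by lia.
  by rewrite addSn binS E natrD !exprS; ring.
Qed.

Lemma offspring0 : offspring vec0 = dirac0 R.
Proof. by rewrite /offspring /next_gen /convn /= !conv0l. Qed.

Lemma conv_geom13_rec g : conv geom13 g = fun v =>
  1 * (a * sh1 (conv geom13 g) v + b * sh2 (conv geom13 g) v) + (1 - a - b) * g v.
Proof.
by rewrite {1}geom13_rec convDl convDl conv_sh1 conv_sh2 conv0l.
Qed.

Lemma offspring_add1 u : offspring (add1 u) = conv geom13 (offspring u).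
Proof. by rewrite /offspring /next_gen /add1 /= -convA. Qed.

Lemma offspring_add3 u : offspring (add3 u) = conv geom13 (offspring u).
Proof.
by rewrite /offspring /next_gen /add3 /= (convCA _ geom13) (convCA _ geom13).
Qed.

Lemma offspring_add2 u : offspring (add2 u) = sh3 (conv geom13 (offspring u)).
Proof.
by rewrite /offspring /next_gen /add2 /= -(convA geom2) (convCA _ geom2)
  /geom2 conv_sh3.
Qed.

Lemma geom2E v : geom2 v = if v.2 == 1%N
  then (1 - a - b) * 'C(v.1.1 + v.1.2, v.1.1)%:R * a ^+ v.1.1 * b ^+ v.1.2 else 0.
Proof. by case: v => -[x y] [|[|z]]. Qed.

Lemma offspring_type1 : offspring (1, 0, 0)%N = geom13.
Proof. by rewrite (offspring_add1 vec0) offspring0 convC conv0l. Qed.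

Lemma offspring_type2 : offspring (0, 1, 0)%N = geom2.
Proof. by rewrite (offspring_add2 vec0) offspring0 convC conv0l. Qed.

Lemma offspring_type3 : offspring (0, 0, 1)%N = geom13.
Proof. by rewrite (offspring_add3 vec0) offspring0 convC conv0l. Qed.

Hypotheses (a0 : 0 <= a) (b0 : 0 <= b).

Lemma pmf_geometric c0 : a + b < 1 -> pmf (fun v : vec => if v.2 == c0
  then (1 - a - b) * 'C(v.1.1 + v.1.2, v.1.1)%:R * a ^+ v.1.1 * b ^+ v.1.2 else 0).
Proof.
move=> ab; have m0 : 0 <= 1 - a - b by lra.
have g0 (x y : nat) : 0 <= (1 - a - b) * 'C(x + y, x)%:R * a ^+ x * b ^+ y.
  by rewrite !mulr_ge0 ?exprn_ge0.
split; first by move=> v; case: ifP.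
(* Vectors are grouped by the sum [n] of their first two coordinates, so that each inner sum is the
   binomial expansion of [(a + b) ^+ n]. *)
pose T : set (nat * nat) := [set: nat] `*`` (fun n => `I_n.+1).
pose e (k : nat * nat) : vec := (k.2, (k.1 - k.2)%N, c0).
transitivity (\esum_(v in [set v : vec | v.2 = c0])
    ((1 - a - b) * 'C(v.1.1 + v.1.2, v.1.1)%:R * a ^+ v.1.1 * b ^+ v.1.2)%:E)%E.
  rewrite [RHS]esum_mkcond; apply: eq_esum => v _.
  case: ifPn => vc; case: ifPn => //.
    by rewrite notin_setE /= => /eqP; rewrite vc.
  by rewrite inE /= => vc'; rewrite vc' eqxx in vc.
rewrite (@reindex_esum _ _ _ T _ e); last first.
  split => [[n k] //|[n k] [n' k'] /=|[[x y] c] /= ->].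
    rewrite !inE /T /= => -[_ /= nk] [_ /= nk'] [kk nn]; congr pair; lia.
  exists (x + y, x)%N; first by split => //=; lia.
  by rewrite /e /=; congr (_, _, _); lia.
rewrite -(@esum_esum _ _ _ setT (fun n => `I_n.+1) (fun n k =>
   ((1 - a - b) * 'C(k + (n - k), k)%:R * a ^+ k * b ^+ (n - k))%:E)); last first.
  by move=> n k _ _; rewrite lee_fin.
transitivity (\esum_(n in [set: nat]) ((1 - a - b) * (a + b) ^+ n)%:E)%E.
  apply: eq_esum => n _; rewrite esum_fset//; last first.
    by move=> k _; rewrite lee_fin.
  rewrite -fsbig_ord /= sumEFin; congr EFin.
  rewrite (addrC a b) exprDn mulr_sumr; apply: eq_bigr => k _.
  rewrite (subnKC (leq_ord k)) -[in RHS]mulr_natr; ring.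
rewrite -nneseries_esumT; last first.
  by move=> n; rewrite lee_fin; apply: mulr_ge0 => //; rewrite exprn_ge0 ?addr_ge0.
apply/cvg_lim => //.
rewrite (_ : (fun _ => _) = EFin \o series (geometric (1 - a - b) (a + b))); last first.
  by apply/funext => n; rewrite /series /= sumEFin.
apply: cvg_EFin; first exact: nearW.
rewrite [X in _ --> X](_ : 1 = (1 - a - b) * (1 - (a + b))^-1); last first.
  by rewrite opprD addrA divff//; lra.
by apply: cvg_geometric_series; rewrite ger0_norm ?addr_ge0.
Qed.

Hypothesis ab1 : a + b <= 1.

(** The recursion makes each value a convex combination of values with fewer parents or fewer
    children, so the bounds follow by induction without summing any convolution. *)
Lemma offspring01 u v : 0 <= offspring u v <= 1.
Proof.
have ab1' := ab1.
have convex (x y z : R) : 0 <= x <= 1 -> 0 <= y <= 1 -> 0 <= z <= 1 ->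
    0 <= 1 * (a * x + b * y) + (1 - a - b) * z <= 1.
  move=> /andP[x0 x1] /andP[y0 y1] /andP[z0 z1]; apply/andP; split.
    have m0 : 0 <= 1 - a - b by lra.
    by rewrite mul1r (addr_ge0 (addr_ge0 (mulr_ge0 a0 x0) (mulr_ge0 b0 y0)) (mulr_ge0 m0 z0)).
  have : a * x <= a by rewrite ler_piMr.
  have : b * y <= b by rewrite ler_piMr.
  have : (1 - a - b) * z <= 1 - a - b by rewrite ler_piMr//; lra.
  lra.
have zero01 : 0 <= (0 : R) <= 1 by rewrite lexx ler01.
(* The third coordinate of [v] stays out of the measure: it decreases only when a type 2 parent is
   removed, which already lowers the measure. *)
have [n] := ubnP (u.1.1 + u.1.2 + u.2 + v.1.1 + v.1.2)%N.
elim: n u v => [//|n IH] u [[x y] z] /= un.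
have conv01 u' z' : (u'.1.1 + u'.1.2 + u'.2 + x + y < n)%N ->
    (forall x' y', (x' + y' < x + y)%N -> 0 <= conv geom13 (offspring u') (x', y', z') <= 1) ->
    0 <= conv geom13 (offspring u') (x, y, z') <= 1.
  move=> u'n h; rewrite conv_geom13_rec; apply: convex; last exact: IH.
    by rewrite /sh1 /=; case: x un u'n h => [|x] ? ? h //; apply: h; lia.
  by rewrite /sh2 /=; case: y un u'n h => [|y] ? ? h //; apply: h; lia.
move: u un => [[[|u1] u2] u3] /= un; last first.
  rewrite (_ : offspring _ = offspring (add1 (u1, u2, u3)))// offspring_add1.
  apply: conv01 => /= [|x' y' xy]; first by lia.
  by rewrite -offspring_add1; apply: IH => /=; lia.
case: u2 un => [|u2] un; last first.
  rewrite (_ : offspring _ = offspring (add2 (0, u2, u3)%N))// offspring_add2.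
  rewrite /sh3 /=; case: z => [//|z].
  apply: conv01 => /= [|x' y' xy]; first by lia.
  by rewrite -offspring_add1; apply: IH => /=; lia.
case: u3 un => [|u3] un; last first.
  rewrite (_ : offspring _ = offspring (add3 (0, 0, u3)%N))// offspring_add3.
  apply: conv01 => /= [|x' y' xy]; first by lia.
  by rewrite -offspring_add3; apply: IH => /=; lia.
by rewrite offspring0 /dirac0; case: (_ == _); rewrite ?lexx ?ler01.
Qed.

(* The first particle either has one more child, of type 1 or 2, or stops. *)
Lemma shv_offspring_add1 u c v : shv c (offspring (add1 u)) v =
  a * shv (add1 c) (offspring (add1 u)) v + b * shv (add2 c) (offspring (add1 u)) v
  + (1 - a - b) * shv c (offspring u) v.
Proof.
by rewrite offspring_add1 {1}conv_geom13_rec shvD mul1r shvD shv1 shv2.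
Qed.

Lemma shv_offspring_add3 u c v : shv c (offspring (add3 u)) v =
  a * shv (add1 c) (offspring (add3 u)) v + b * shv (add2 c) (offspring (add3 u)) v
  + (1 - a - b) * shv c (offspring u) v.
Proof.
by rewrite offspring_add3 {1}conv_geom13_rec shvD mul1r shvD shv1 shv2.
Qed.

(** The obligatory type 3 child is collected when the parent stops, hence [add3] in the last term
    only. *)
Lemma shv_offspring_add2 u c v : shv c (offspring (add2 u)) v =
  a * shv (add1 c) (offspring (add2 u)) v + b * shv (add2 c) (offspring (add2 u)) v
  + (1 - a - b) * shv (add3 c) (offspring u) v.
Proof.
rewrite offspring_add2 -!shv3 {1}conv_geom13_rec shvD mul1r shvD.
by rewrite -!shv1 -!shv2.
Qed.

End geometric.

(** * The branching property *)

Definition vsub (u v : vec) : vec := (u.1.1 - v.1.1, u.1.2 - v.1.2, u.2 - v.2)%N.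

Lemma vsub0 u : vsub u vec0 = u.
Proof. by case: u => -[x y] z; rewrite /vsub /= !subn0. Qed.

Lemma vsubv u : vsub u u = vec0.
Proof. by rewrite /vsub !subnn. Qed.

Lemma vle_refl u : vle u u.
Proof. by rewrite /vle !leqnn. Qed.

Lemma vsub_add1 u v : vle (add1 v) u -> vsub u v = add1 (vsub u (add1 v)).
Proof.
by rewrite /vle /vsub /add1 /= => /and3P[h _ _]; congr (_, _, _); lia.
Qed.

Lemma vsub_add2 u v : vle (add2 v) u -> vsub u v = add2 (vsub u (add2 v)).
Proof.
by rewrite /vle /vsub /add2 /= => /and3P[_ h _]; congr (_, _, _); lia.
Qed.

Lemma vsub_add3 u v : vle (add3 v) u -> vsub u v = add3 (vsub u (add3 v)).
Proof.
by rewrite /vle /vsub /add3 /= => /and3P[_ _ h]; congr (_, _, _); lia.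
Qed.

Lemma vle_up1 v x s j : vle v (s j) -> vle v (up1 x s j).
Proof.
by rewrite /up1; case: ifP => // _; rewrite /vle /= => /and3P[? ? ?];
  apply/and3P; split; lia.
Qed.

Lemma vle_up2 v x s j : vle v (s j) -> vle v (up2 x s j).
Proof.
by rewrite /up2; case: ifP => // _; [|case: ifP => // _];
  rewrite /vle /= => /and3P[? ? ?]; apply/and3P; split; lia.
Qed.

Section levels.
Variables (R : realType) (w : env R).
Hypothesis tr : hits_every_level w.
Implicit Types (M L x y : int) (s t : state) (u c v : vec).

(** At the three unit vectors these are the [alpha], [beta] and [gamma] of the theorem, obtained
    from entrance probabilities without the quotients; [gammaE] and [alpha_betaE] prove the
    agreement. *)
Definition step_enter L v : R := q w L * enter w L v (L - 1).
Local Notation a_ L := (step_enter L (add1 vec0)).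
Local Notation b_ L := (step_enter L (add2 vec0)).
Local Notation g_ L := (step_enter L (add3 vec0)).

Lemma step_enter_ge0 L v : 0 <= step_enter L v.
Proof.
have [q0 _ _ _] := qP w L; have /andP[h0 _] := enter01 w L v (L - 1).
exact: mulr_ge0.
Qed.

Lemma step_enter_sum L : a_ L + b_ L + g_ L + p1 w L + p2 w L = 1.
Proof.
have [_ _ _ <-] := qP w L; rewrite /step_enter -!mulrDr enter_sum ?mulr1//; lia.
Qed.

(** The step down from [L] is followed by the entrance law of [[L, oo)], so the equation links only
    positions at or above [L]. *)
Lemma vlim_level M L (F : int -> state -> R) s : L < M -> prob_valued M F ->
  (forall y s t, M <= y -> agree L s t -> F y s = F y t) ->
  vlim w M F L s = a_ L * vlim w M F L (up1 (L - 1) s)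
    + b_ L * vlim w M F L (up2 (L - 2) s)
    + g_ L * vlim w M F (L + 1) (up2 (L - 1) s)
    + p1 w L * vlim w M F (L + 1) (up1 L s)
    + p2 w L * vlim w M F (L + 2) (up2 L s).
Proof.
move=> LM F01 FL; rewrite vlim_step//.
rewrite -[vlim w M F (L - 1) s](@vlim_vlim _ _ tr L)//; last exact: ltW.
rewrite vlim_enter; first by rewrite /step_enter; ring.
  lia.
move=> y t t' _; apply: vlim_rel; [exact: agree_up1|exact: agree_up2|exact: FL].
Qed.

Variables (M L : int) (LM : L < M) (F : state -> R).
Hypothesis F01 : forall s, 0 <= F s <= 1.
Hypothesis F_agree : forall s t, agree (L + 1) s t -> F s = F t.
Hypothesis m_gt0 : 0 < 1 - a_ L - b_ L.
Variable v : vec.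

Local Notation K := (offspring (a_ L) (b_ L)).

Lemma returns_le1 : a_ L + b_ L <= 1.
Proof. by move: m_gt0; lra. Qed.

(* [F] times the probability that the level-[L] offspring still to come sum to
   [v - c], when [u] level-[L + 1] particles are already completed. *)
Definition brood u c : int -> state -> R :=
  fun _ t => F t * shv c (K (vsub (t (L + 1)) u)) v.

Lemma brood01 u c : prob_valued M (brood u c).
Proof.
move=> y t _; have /andP[f0 f1] := F01 t.
have /andP[k0 k1] : 0 <= shv c (K (vsub (t (L + 1)) u)) v <= 1.
  rewrite /shv; case: ifP => _; last by rewrite lexx ler01.
  by apply: offspring01; rewrite ?step_enter_ge0 ?returns_le1.
by rewrite /brood mulr_ge0//= mulr_ile1.
Qed.

Lemma brood_agree u c y s t : agree (L + 1) s t -> brood u c y s = brood u c y t.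
Proof. by move=> st; rewrite /brood (F_agree st) st. Qed.

Lemma vlim_brood_agree u c y s t : agree (L + 1) s t ->
  vlim w M (brood u c) y s = vlim w M (brood u c) y t.
Proof.
move=> st; apply: (@vlim_rel _ _ (agree (L + 1))) => //.
- by move=> *; apply: agree_up1.
- by move=> *; apply: agree_up2.
- by move=> z s' t' _; apply: brood_agree.
Qed.

Lemma agree_up1_below s : agree (L + 1) (up1 (L - 1) s) s.
Proof. by move=> j Lj; rewrite /up1 ifF//; lia. Qed.

Lemma agree_up2_below s : agree (L + 1) (up2 (L - 2) s) s.
Proof. by move=> j Lj; rewrite /up2 !ifF//; lia. Qed.

(** [brood u c] ignores the counts at level [L], so an excursion that returns to [L] changes
    nothing; the geometric series of returns is summed by moving these terms to the left. *)
Lemma vlim_brood_level u c s : (1 - a_ L - b_ L) * vlim w M (brood u c) L s =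
    g_ L * vlim w M (brood u c) (L + 1) (up2 (L - 1) s)
    + p1 w L * vlim w M (brood u c) (L + 1) (up1 L s)
    + p2 w L * vlim w M (brood u c) (L + 2) (up2 L s).
Proof.
have := @vlim_level M L (brood u c) s LM (@brood01 u c).
rewrite (vlim_brood_agree u c _ (agree_up1_below s)).
rewrite (vlim_brood_agree u c _ (agree_up2_below s)).
move=> E; rewrite mulrBl mulrBl mul1r {1}E; first by ring.
move=> y t t' _ tt; apply: brood_agree => j Lj; apply: tt; lia.
Qed.

(** Counts only grow, so a lower bound at level [L + 1] persists along the walk. It guards the
    truncated subtraction in [brood]. *)
Let above d s t := s = t /\ vle d (s (L + 1)).

Lemma above_up1 d x s t : above d s t -> above d (up1 x s) (up1 x t).
Proof. by move=> [-> st]; split => //; apply: vle_up1. Qed.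

Lemma above_up2 d x s t : above d s t -> above d (up2 x s) (up2 x t).
Proof. by move=> [-> st]; split => //; apply: vle_up2. Qed.

Lemma vlim_brood_split u c u' c' y s : vle u' (s (L + 1)) ->
  (forall t : vec, vle u' t -> shv c (K (vsub t u)) v =
    a_ L * shv (add1 c) (K (vsub t u)) v + b_ L * shv (add2 c) (K (vsub t u)) v
    + (1 - a_ L - b_ L) * shv c' (K (vsub t u')) v) ->
  vlim w M (brood u c) y s =
    a_ L * vlim w M (brood u (add1 c)) y s + b_ L * vlim w M (brood u (add2 c)) y s
    + (1 - a_ L - b_ L) * vlim w M (brood u' c') y s.
Proof.
move=> us E; rewrite -vlim_lin; [|exact: brood01|exact: brood01|exact: brood01].
apply: (@vlim_rel _ _ (above u')) => // [? ? ?|? ? ?|z t t' _ [<- ut]].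
- exact: above_up1.
- exact: above_up2.
- by rewrite /brood E//; ring.
Qed.

(** The function that interpolates between the two expectations: completed parents are represented
    by the children already counted in [s L], and the kernel acts only on parents completed
    later. *)
Let Gup y s := vlim w M (brood (s (L + 1)) (s L)) y s.

Lemma Gup_agree y s t : agree L s t -> Gup y s = Gup y t.
Proof.
move=> st; rewrite /Gup !st//; last lia.
by apply: vlim_brood_agree => j Lj; apply: st; lia.
Qed.

Lemma Gup01 : prob_valued L Gup.
Proof. by move=> y s _; apply: vlim01; apply: brood01. Qed.

(** Here the geometric form of the offspring law enters. A return to [L] by a jump of type 1 or 2
    adds one child to the current parent; leaving [L] upwards completes that parent. These are the
    cases of the one-child recursion, with the same weights. *)
Lemma Gup_level s : Gup L s = q w L * vlim w L Gup (L - 1) s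
  + p1 w L * Gup (L + 1) (up1 L s) + p2 w L * Gup (L + 2) (up2 L s).
Proof.
have LL : L - 1 < L by lia.
rewrite (vlim_enter _ _ LL); last by move=> y t t' _; apply: Gup_agree.
set u := s (L + 1); set c := s L.
have L0 : (L + 1 == L :> int) = false by lia.
have L1 : (L == L + 1 :> int) = false by lia.
have L2 : (L == L - 2 + 1 :> int) = false by lia.
have L3 : (L == L + 2 :> int) = false by lia.
have -> : Gup L (up1 (L - 1) s) = vlim w M (brood u (add1 c)) L s.
  rewrite /Gup {1 2}/up1 subrK eqxx L0.
  exact/vlim_brood_agree/agree_up1_below.
have -> : Gup L (up2 (L - 2) s) = vlim w M (brood u (add2 c)) L s.
  rewrite /Gup {1 2}/up2 subrK eqxx L0 L2 ifF; last by lia.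
  exact/vlim_brood_agree/agree_up2_below.
have E2 : L - 1 + 2 = L + 1 :> int by lia.
have -> : Gup (L + 1) (up2 (L - 1) s) =
    vlim w M (brood (add2 u) (add3 c)) (L + 1) (up2 (L - 1) s).
  by rewrite /Gup {1 2}/up2 subrK !eqxx L0 E2 eqxx.
have -> : Gup (L + 1) (up1 L s) =
    vlim w M (brood (add1 u) c) (L + 1) (up1 L s).
  by rewrite /Gup {1 2}/up1 eqxx L1.
have -> : Gup (L + 2) (up2 L s) =
    vlim w M (brood (add3 u) c) (L + 2) (up2 L s).
  by rewrite /Gup {1 2}/up2 eqxx L1 L3.
have r1 c' (t : vec) : vle (add1 u) t -> shv c' (K (vsub t u)) v =
    a_ L * shv (add1 c') (K (vsub t u)) v + b_ L * shv (add2 c') (K (vsub t u)) v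
    + (1 - a_ L - b_ L) * shv c' (K (vsub t (add1 u))) v.
  by move=> /vsub_add1 ->; exact: shv_offspring_add1.
have r2 c' (t : vec) : vle (add2 u) t -> shv c' (K (vsub t u)) v =
    a_ L * shv (add1 c') (K (vsub t u)) v + b_ L * shv (add2 c') (K (vsub t u)) v
    + (1 - a_ L - b_ L) * shv (add3 c') (K (vsub t (add2 u))) v.
  by move=> /vsub_add2 ->; exact: shv_offspring_add2.
have r3 c' (t : vec) : vle (add3 u) t -> shv c' (K (vsub t u)) v =
    a_ L * shv (add1 c') (K (vsub t u)) v + b_ L * shv (add2 c') (K (vsub t u)) v
    + (1 - a_ L - b_ L) * shv c' (K (vsub t (add3 u))) v.
  by move=> /vsub_add3 ->; exact: shv_offspring_add3.
(* Each of the three ways up from [L] has just completed one parent at level [L + 1], so the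
   recursion for its type applies from there on. *)
have u1 : vle (add1 u) (up1 L s (L + 1)) by rewrite /up1 eqxx vle_refl.
have u2 : vle (add2 u) (up2 (L - 1) s (L + 1)).
  by rewrite /up2 subrK L0 E2 eqxx vle_refl.
have u3 : vle (add3 u) (up2 L s (L + 1)) by rewrite /up2 eqxx vle_refl.
have m0 : 1 - a_ L - b_ L != 0 by rewrite gt_eqF.
apply: (mulfI m0); rewrite /Gup -/u -/c.
have e0 := vlim_brood_level u c s.
have e1 := vlim_brood_level u (add1 c) s.
have e2 := vlim_brood_level u (add2 c) s.
rewrite (vlim_brood_split _ u1 (r1 c)) (vlim_brood_split _ u2 (r2 c))
  (vlim_brood_split _ u3 (r3 c)) in e0.
rewrite e0.
have -> : forall X1 X2 Y1 Y2 Y3 : R, (1 - a_ L - b_ L) *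
    (q w L * (enter w L (add1 vec0) (L - 1) * X1 + enter w L (add2 vec0) (L - 1) * X2
    + enter w L (add3 vec0) (L - 1) * Y2) + p1 w L * Y1 + p2 w L * Y3) =
  a_ L * ((1 - a_ L - b_ L) * X1) + b_ L * ((1 - a_ L - b_ L) * X2)
  + (1 - a_ L - b_ L) * (g_ L * Y2 + p1 w L * Y1 + p2 w L * Y3).
  by move=> *; rewrite /step_enter; ring.
by rewrite e1 e2; ring.
Qed.

(** [Gup], extended below [L] by its entrance expectation, solves the one-step equation below [M].
    At the exit no parent remains and the kernel is a point mass, which gives the left side; with
    empty counts all parents are still to come, which gives the right side. *)
Lemma vlim_branching x : L <= x ->
  vlim w M (fun _ s => F s * (s L == v)%:R) x state0 =
  vlim w M (fun _ s => F s * K (s (L + 1)) v) x state0.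
Proof.
move=> Lx.
transitivity (vlim w M (vlim w L Gup) x state0).
  apply: (@vlim_rel _ _ eq) => // [? ? ? ->|? ? ? ->|y s _ My <-] //.
  rewrite vlim_exit; last by lia.
  by rewrite /Gup vlim_exit// /brood vsubv offspring0 shv_dirac0.
rewrite (@vlim_harmonic _ _ _ 1)//.
- by rewrite vlim_exit// /Gup /brood /=; apply: (@vlim_rel _ _ eq)
    => // [? ? ? ->|? ? ? ->|y s _ My <-] //; rewrite vsub0 shv0.
- move=> y s; have /andP[v0 v1] := vlim01 w y s Gup01; by rewrite ger0_norm.
- move=> y s yM; have [yL|Ly] := ltrP y L; first by rewrite vlim_step//; exact: Gup01.
  move: Ly; rewrite le_eqVlt => /orP[/eqP <-|Ly].
    rewrite vlim_exit// Gup_level (@vlim_exit _ _ L _ (L + 1)) ?lerDl//.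
    by rewrite (@vlim_exit _ _ L _ (L + 2)) ?lerDl.
  have [y0 [y1 [y2 y3]]] : L <= y /\ L <= y - 1 /\ L <= y + 1 /\ L <= y + 2 by lia.
  rewrite (vlim_exit _ _ _ y0) (vlim_exit _ _ _ y1).
  rewrite (vlim_exit _ _ _ y2) (vlim_exit _ _ _ y3).
  have U1 j : j <= L + 1 -> up1 y s j = s j by move=> jL; rewrite /up1 ifF//; lia.
  have U2 j : j <= L + 1 -> up2 y s j = s j by move=> jL; rewrite /up2 !ifF//; lia.
  rewrite {1}/Gup vlim_step//; last exact: brood01.
  by rewrite /Gup !U1 ?lerDl// !U2 ?lerDl.
Qed.

End levels.

(** * Entrance probabilities in closed form *)

Section enter_formula.
Variables (R : realType) (w : env R).
Hypothesis tr : hits_every_level w.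
Implicit Types L : int.
Local Notation a_ L := (step_enter w L (add1 vec0)).
Local Notation b_ L := (step_enter w L (add2 vec0)).
Local Notation g_ L := (step_enter w L (add3 vec0)).

(** Excursions that bring the walk back to [L - 1] leave the count at [L] untouched. What remains is
    an excursion below [L - 1] ending at [L], of type 2, and the direct jumps of types 1 and 3. *)
Lemma enter_level L v : (1 - a_ (L - 1) - b_ (L - 1)) * enter w L v (L - 1) =
  g_ (L - 1) * (add2 vec0 == v)%:R + p1 w (L - 1) * (add1 vec0 == v)%:R
  + p2 w (L - 1) * (add3 vec0 == v)%:R.
Proof.
have LL : L - 1 < L by lia.
have := vlim_level tr state0 LL (@prob_valued_nat R L (fun _ s => s L == v)).
have ll (x : int) (s : state) : s L = vec0 -> vlim w L (last_type R L v) x s = enter w L v x.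
  move=> s0; congr (limn _); apply/funext => n; exact: value_last_type.
have E1 : L - 1 + 1 = L :> int by lia.
have E2 : L - 1 + 2 = L + 1 :> int by lia.
have E3 : L - 1 - 1 + 1 = L - 1 :> int by lia.
have E4 : L - 1 - 2 + 1 = L - 2 :> int by lia.
have E5 : L - 1 - 2 + 2 = L - 1 :> int by lia.
have E6 : L - 1 - 1 + 2 = L :> int by lia.
have E7 : (L == L - 1) = false by lia.
have E8 : (L == L - 2) = false by lia.
rewrite -/(last_type R L v) !E1 E2 -/(enter w L v (L - 1)).
rewrite (ll _ (up1 _ _)); last by rewrite /up1 E3 E7.
rewrite (ll _ (up2 _ _)); last by rewrite /up2 E4 E5 E7 E8.
rewrite !(@vlim_exit _ _ L _ L)// !(@vlim_exit _ _ L _ (L + 1)) ?lerDl//.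
rewrite /last_type /up1 /up2 E1 E3 E6 E7 eqxx.
move=> E; rewrite mulrBl mulrBl mul1r {1}E; first by rewrite /state0; ring.
by move=> y s t _ st; rewrite st//; lia.
Qed.

Lemma enter1 L : (1 - a_ (L - 1) - b_ (L - 1)) * enter w L (add1 vec0) (L - 1)
  = p1 w (L - 1).
Proof. by rewrite enter_level /= !mulr0 mulr1 add0r addr0. Qed.

Lemma enter2 L : (1 - a_ (L - 1) - b_ (L - 1)) * enter w L (add2 vec0) (L - 1)
  = g_ (L - 1).
Proof. by rewrite enter_level /= !mulr0 mulr1 !addr0. Qed.

Lemma enter3 L : (1 - a_ (L - 1) - b_ (L - 1)) * enter w L (add3 vec0) (L - 1)
  = p2 w (L - 1).
Proof. by rewrite enter_level /= !mulr0 mulr1 !add0r. Qed.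

Lemma vlim_exit_point L (j : int) : vlim w L (fun y _ => (y == L + j)%:R) (L - 1) state0 =
  (enter w L (add1 vec0) (L - 1) + enter w L (add2 vec0) (L - 1)) * (j == 0)%:R
  + enter w L (add3 vec0) (L - 1) * (j == 1)%:R.
Proof.
rewrite vlim_enter//; last by lia.
by rewrite -[X in X == L + j]addr0 !(inj_eq (addrI L)) !(eq_sym j); ring.
Qed.

End enter_formula.

(** * Finite-horizon events of the walk *)

Lemma measurable_coordinate n (k : int) : measurable [set X : traj | X n = k].
Proof. by apply: sub_sigma_algebra; exists n, k. Qed.

Definition prefix_event n (A : set traj) :=
  forall X Y : traj, (forall i, (i <= n)%N -> X i = Y i) -> A X -> A Y.

Lemma measurable_prefix n (A : set traj) : prefix_event n A -> measurable A.
Proof.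
move=> An.
pose cyl (s : seq int) : set traj := [set X | forall i, (i <= n)%N -> X i = nth 0 s i].
have -> : A = \bigcup_(s in [set s | exists2 X, A X & cyl s X]) cyl s.
  apply/seteqP; split => X.
    move=> AX; have cX : cyl (mkseq X n.+1) X by move=> i ik; rewrite nth_mkseq.
    by exists (mkseq X n.+1) => //; exists X.
  move=> [s [Y AY sY] sX]; apply: An AY => i ik.
  by rewrite sX// sY.
rewrite bigcup_mkcond; apply: countable_bigcupT_measurable => [|s].
  exact: countableP.
case: ifP => // _.
rewrite (_ : cyl s =
    \bigcap_(i in [set i | (i <= n)%N]) [set X | X i = nth 0 s i]).
  by apply: bigcap_measurable => [|i _]; [exists 0%N|exact: measurable_coordinate].
by apply/seteqP; split.
Qed.

Section law.
Variables (R : realType) (w : env R) (mu : probability traj R).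
Implicit Types (n m : nat) (x k : int) (D : set traj).

Definition scons x (X : traj) : traj := fun n => if n is n'.+1 then X n' else x.

(** The base case lets the constant trajectory represent all trajectories from [x]; this is faithful
    for events decided by the first [n] steps. *)
Fixpoint psum n x D : R :=
  if n is n'.+1 then
    q w x * psum n' (x - 1) [set X | D (scons x X)]
    + p1 w x * psum n' (x + 1) [set X | D (scons x X)]
    + p2 w x * psum n' (x + 2) [set X | D (scons x X)]
  else `[< D (fun=> x) >]%:R.

Definition cyl m (x : traj) : set traj := [set X | forall i, (i <= m)%N -> X i = x i].

Lemma prefix_cyl m (x : traj) : prefix_event m (cyl m x).
Proof. by move=> X Y XY Xx i im; rewrite -XY// Xx. Qed.

Lemma measurable_cyl m (x : traj) : measurable (cyl m x).
Proof. exact: measurable_prefix (@prefix_cyl m x). Qed.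

(** Position [m] is read from [Y 0], so the continuation starts at the current point of the walk. *)
Definition splice m (x Y : traj) : traj := fun i => if (i < m)%N then x i else Y (i - m)%N.

Definition set_step m (x : traj) (y : int) : traj := fun i => if i == m.+1 then y else x i.

Lemma cyl_set_step m (x : traj) y : cyl m.+1 (set_step m x y) = cyl m x `&` [set X | X m.+1 = y].
Proof.
apply/seteqP; split => X.
  move=> h; split; last by have := h m.+1 (leqnn _); rewrite /set_step eqxx.
  by move=> i im; rewrite h ?(leqW im)// /set_step ltn_eqF.
move=> [h1 /= h2] i; rewrite /set_step; case: eqVneq => [->//|im im1].
by apply: h1; rewrite -ltnS ltn_neqAle im.
Qed.

Hypothesis mu_walk : forall n (x : traj), mu (cyl n.+1 x) =
  (mu (cyl n x) * (mass (w (x n)) (x n.+1 - x n))%:E)%E.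

Lemma mu_cyl_step m (x : traj) z : mu (cyl m x `&` [set X | X m.+1 = x m + z]) =
  (mu (cyl m x) * (mass (w (x m)) z)%:E)%E.
Proof.
rewrite -cyl_set_step mu_walk; congr (mu _ * _)%E.
  apply/seteqP; split=> X h i im; rewrite (h i im) /set_step ltn_eqF//.
by rewrite /set_step eqxx ltn_eqF// (addrC (x m)) addrK.
Qed.

Lemma mu_cylE m (x : traj) : mu (cyl m x) = (fine (mu (cyl m x)))%:E.
Proof. by rewrite fineK// fin_num_measure//; exact: measurable_cyl. Qed.

(** The three jump weights sum to 1, so they exhaust the mass of the cylinder, and every other
    continuation is null. *)
Lemma mu_step_split m (x : traj) E : measurable E -> E `<=` cyl m x ->
  mu E = (mu (E `&` [set X | X m.+1 = (x m - 1)%R])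
    + mu (E `&` [set X | X m.+1 = (x m + 1)%R])
    + mu (E `&` [set X | X m.+1 = (x m + 2)%R]))%E.
Proof.
pose A (z : int) : set traj := [set X | X m.+1 = x m + z].
have mA z : measurable (A z) by exact: measurable_coordinate.
have split4 B : measurable B -> mu B = (mu (B `&` A (-1)%R) + mu (B `&` A 1%R)
    + mu (B `&` A 2%R) + mu (B `\` A (-1)%R `\` A 1%R `\` A 2%R))%E.
  move=> mB.
  rewrite (measureDI mu mB (mA (-1)%R)).
  have mB1 := measurableD mB (mA (-1)%R).
  rewrite (measureDI mu mB1 (mA 1%R)).
  have mB2 := measurableD mB1 (mA 1%R).
  rewrite (measureDI mu mB2 (mA 2%R)).
  have -> : (B `\` A (-1)%R) `&` A 1%R = B `&` A 1%R.
    apply/seteqP; split => X [] => [[BX _] AX //|BX AX]; split => //; split => //.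
    by move: AX; rewrite /A /= => ->; lia.
  have -> : (B `\` A (-1)%R `\` A 1%R) `&` A 2%R = B `&` A 2%R.
    apply/seteqP; split => X [] => [[[BX _] _] AX //|BX AX]; split => //.
    by split; [split|] => //; move: AX; rewrite /A /= => ->; lia.
  rewrite addeC (addeC _ (mu (B `&` A 1%R))).
  by rewrite (addeC (mu (_ `\` _))) !addeA.
move=> mE Ec; rewrite (split4 _ mE).
suff -> : mu (E `\` A (-1)%R `\` A 1%R `\` A 2%R) = 0%E by rewrite adde0.
have mc := @measurable_cyl m x.
have := split4 _ mc; rewrite !mu_cyl_step /mass /=.
set r := mu (_ `\` _ `\` _); set c := mu (cyl m x).
have cE : c = (fine c)%:E by exact: mu_cylE.
have mr : measurable (cyl m x `\` A (-1)%R `\` A 1%R `\` A 2%R).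
  by do !apply: measurableD.
have rE : r = (fine r)%:E by rewrite fineK// fin_num_measure.
have [_ _ _ ws] := qP w (x m).
rewrite cE rE -!EFinM -!EFinD => -[]; rewrite -!mulrDr ws mulr1.
move=> /eqP; rewrite -subr_eq0 opprD addNKr oppr_eq0 => /eqP r0.
apply/eqP; rewrite eq_le measure_ge0 andbT.
have -> : 0%E = r by rewrite rE r0.
apply: le_measure; rewrite ?inE//; first by do !apply: measurableD.
by move=> X [[[EX h1] h2] h3]; split => //; split => //; split => //; exact: Ec.
Qed.

Lemma mu_splice m n (x : traj) D : prefix_event (m + n) D -> mu (cyl m x `&` D) =
  (mu (cyl m x) * (psum n (x m) [set Y | D (splice m x Y)])%:E)%E.
Proof.
elim: n m x => [|n IH] m x Dn /=.
  have Dx X : cyl m x X -> D X <-> D (splice m x (fun=> x m)).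
    move=> cX; split; apply: Dn => i; rewrite addn0 /splice => im;
    by rewrite cX//; case: ltngtP im => // ->.
  case: asboolP => h.
    rewrite mule1; congr (mu _); apply/seteqP; split => X; first by case.
    by move=> cX; split => //; apply/Dx.
  rewrite mule0 (_ : _ `&` _ = set0) ?measure0//.
  by apply/seteqP; split => X // [cX DX]; apply: h; apply/(Dx X).
have mD := measurable_prefix Dn.
rewrite (@mu_step_split m x); [|exact: measurableI (@measurable_cyl m x) mD|by move=> X []].
have step z : mu (cyl m x `&` D `&` [set X | X m.+1 = x m + z]) =
    (mu (cyl m x) * (mass (w (x m)) z * psum n (x m + z)
      [set Y | D (splice m x (scons (x m) Y))])%:E)%E.
  rewrite setIAC -cyl_set_step IH; last by rewrite addSnnS.
  rewrite {1}cyl_set_step mu_cyl_step EFinM muleA; congr (_ * (psum _ _ _)%:E)%E.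
    by rewrite /set_step eqxx.
  apply/funext => Y /=; congr D; apply/funext => i; rewrite /splice /set_step.
  case: (ltngtP i m) => im.
  - by rewrite ltnS (ltnW im) ltn_eqF// ltnW.
  - rewrite ltnS leqNgt im /= -{2}(subnK im) addnS subSn//; last exact: leq_addl.
    by rewrite /scons addnK.
  - by rewrite im ltnSn ltn_eqF//= subnn.
rewrite !step /mass /= mu_cylE -!EFinM -!EFinD; congr EFin.
by rewrite /q /p1 /p2; ring.
Qed.

Lemma mu_prefix k n D : mu [set X | X 0%N = k] = 1%E -> prefix_event n D ->
  mu ([set X | X 0%N = k] `&` D) = (psum n k D)%:E.
Proof.
move=> mu0 Dn; have E : [set X | X 0%N = k] = cyl 0 (fun=> k).
  apply/seteqP; split => X; last by move=> /(_ 0%N); apply.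
  by move=> X0 i; rewrite leqn0 => /eqP ->.
rewrite E (@mu_splice 0 n)// -E mu0 mul1e; congr (psum _ _ _)%:E.
by apply/funext => Y /=; congr D; apply/funext => i; rewrite /splice ltn0 subn0.
Qed.

End law.

(** * Counts along a trajectory up to its entrance time *)

Definition step_state (x y : int) (s : state) : state :=
  if y == x + 1 then up1 x s else if y == x + 2 then up2 x s else s.

Fixpoint run (s : state) (X : traj) (n : nat) : state :=
  if n is n'.+1 then step_state (X n') (X n'.+1) (run s X n') else s.

Definition is_jump (z : int) := [|| z == -1, z == 1 | z == 2].

(** Requiring legal jumps costs no probability and makes pathwise counting possible, since a legal
    downward step cannot skip a level. *)
Definition first_hit (M : int) (X : traj) (m : nat) := [/\ M <= X m,
  forall l, (l < m)%N -> X l < M & forall l, (l < m)%N -> is_jump (X l.+1 - X l)].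

Definition hit_by M n (D : int -> state -> Prop) s : set traj :=
  [set X | exists2 m, (m <= n)%N & first_hit M X m /\ D (X m) (run s X m)].

Lemma run_shift s (X : traj) n :
  run s X n.+1 = run (step_state (X 0%N) (X 1%N) s) (fun i => X i.+1) n.
Proof. by elim: n => [//|n IH]; rewrite -[LHS]/(step_state _ _ (run s X n.+1)) IH. Qed.

Lemma eq_run s (X Y : traj) n : (forall i, (i <= n)%N -> X i = Y i) ->
  run s X n = run s Y n.
Proof.
elim: n => [//|n IH] XY /=; rewrite !XY// IH// => i ni; apply: XY; exact: leqW.
Qed.

Lemma prefix_hit_by M n D s : prefix_event n (hit_by M n D s).
Proof.
move=> X Y XY [m mn [[Xm Xl Xj] DX]]; exists m => //; split; last first.
  by rewrite -XY// -(@eq_run s X)// => i im; apply: XY; apply: leq_trans mn.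
split; first by rewrite -XY.
- by move=> l lm; rewrite -XY ?Xl// (leq_trans _ mn)// ltnW.
- move=> l lm; have ln := leq_trans lm mn.
  by rewrite -(XY _ ln) -(XY _ (ltnW ln)) Xj.
Qed.

Lemma hit_by_start M n D s (X : traj) : M <= X 0%N ->
  hit_by M n D s X <-> D (X 0%N) s.
Proof.
move=> X0; split=> [[[|m] _ [[Xm Xl _] //]]|DX].
  by have := Xl 0%N isT; rewrite ltNge X0.
by exists 0%N.
Qed.

Lemma hit_by_step M n D s (X : traj) x z : x < M -> is_jump z -> X 0%N = x + z ->
  hit_by M n.+1 D s (scons x X) <-> hit_by M n D (step_state x (x + z) s) X.
Proof.
move=> xM jz X0; split.
  move=> [[|m] mn [[Xm Xl Xj] DX]]; first by move: Xm; rewrite leNgt xM.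
  exists m => //; split; last by rewrite run_shift /= X0 in DX.
  split=> // l lm; [exact: (Xl l.+1)|exact: (Xj l.+1)].
move=> [m mn [[Xm Xl Xj] DX]]; exists m.+1 => //; split; last first.
  by rewrite run_shift /= X0.
split=> // -[|l] lm //; [exact: Xl| |exact: Xj].
by rewrite /= X0 addrAC subrr add0r.
Qed.

Section law.
Variables (R : realType) (w : env R).

Lemma eq_psum n x (D D' : set traj) : (forall X, X 0%N = x -> D X <-> D' X) ->
  psum w n x D = psum w n x D'.
Proof.
elim: n x D D' => [|n IH] x D D' DD /=.
  by congr (nat_of_bool _)%:R; apply: asbool_equiv_eq; exact: DD.
congr (_ * _ + _ * _ + _ * _); apply: IH => X _; exact: DD.
Qed.

Lemma psum_cst n x (P : Prop) : psum w n x [set X | P] = `[< P >]%:R.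
Proof.
elim: n x => [//|n IH] x /=; rewrite !IH -!mulrDl.
by have [_ _ _ ->] := qP w x; rewrite mul1r.
Qed.

Lemma psum_hit M n D x s :
  psum w n x (hit_by M n D s) = value w M n (fun y s => `[< D y s >]%:R) x s.
Proof.
have [Mx|xM] := lerP M x.
  rewrite value_exit// -(@psum_cst n x); apply: eq_psum => X X0.
  by rewrite hit_by_start X0.
elim: n x s xM => [|n IH] x s xM.
  rewrite /= leNgt xM /=; case: asboolP => // -[[|//] _ [[]]].
  by rewrite leNgt xM.
have {}IH y t : psum w n y (hit_by M n D t) =
    value w M n (fun y s => `[< D y s >]%:R) y t.
  have [My|yM] := lerP M y; last exact: IH.
  rewrite value_exit// -(@psum_cst n y); apply: eq_psum => X X0.
  by rewrite hit_by_start X0.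
rewrite valueS// -!IH /=; congr (_ * _ + _ * _ + _ * _); apply: eq_psum => X X0.
- rewrite /= (hit_by_step _ _ _ xM _ X0)// /step_state !(inj_eq (addrI x))//.
- rewrite /= (hit_by_step _ _ _ xM _ X0)// /step_state !(inj_eq (addrI x))//.
- rewrite /= (hit_by_step _ _ _ xM _ X0)// /step_state !(inj_eq (addrI x))//.
Qed.

Variables (k : int) (mu : probability traj R).
Hypothesis walk : walk_law w k mu.
Hypothesis tr : hits_every_level w.

Lemma mu_hit_by M n D s : mu ([set X | X 0%N = k] `&` hit_by M n D s) =
  (value w M n (fun y s => `[< D y s >]%:R) k s)%:E.
Proof.
case: walk => w0 wS; rewrite (mu_prefix wS w0 (@prefix_hit_by M n D s)).
by rewrite psum_hit.
Qed.

(** [E] is controlled only on paths that hit [[M, oo)]. The hits by time [n] have probability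
    tending to 1, which bounds the part of [E] missed by the finite-horizon value. *)
Lemma mu_vlim M (E : set traj) D s : measurable E ->
  (forall X m, X 0%N = k -> first_hit M X m -> E X <-> D (X m) (run s X m)) ->
  mu E = (vlim w M (fun y s => `[< D y s >]%:R) k s)%:E.
Proof.
move=> mE ED.
pose A n := [set X : traj | X 0%N = k] `&` hit_by M n (fun _ _ => True) s.
have mA n : measurable (A n).
  apply: measurableI; first exact: measurable_coordinate.
  exact: measurable_prefix (@prefix_hit_by M n _ s).
have EA n : E `&` A n = [set X | X 0%N = k] `&` hit_by M n D s.
  apply/seteqP; split => X.
    by move=> [EX [X0 [m mn [hm _]]]]; split => //; exists m => //; split => //;
      apply/(ED X m X0 hm).
  move=> [X0 [m mn [hm DX]]]; split; first by apply/(ED X m X0 hm).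
  by split => //; exists m.
have muA n : mu (A n) = (value w M n (fun _ _ => 1) k state0)%:E.
  rewrite mu_hit_by -(@value1_state _ _ _ _ _ s); congr (_%:E).
  by apply: value_eq => *; rewrite asboolT.
have muE : mu E = (fine (mu E))%:E by rewrite fineK// fin_num_measure.
rewrite muE; congr EFin; apply/esym/vlimE; apply/cvgrPdist_le => e e0.
have /cvgrPdist_le /(_ e e0) h := tr M k.
near=> n.
have h1 : `|1 - value w M n (fun _ _ => 1) k state0| <= e by near: n; exact: h.
apply: le_trans h1.
set r := value w M n _ k state0; set v := value w M n _ k s.
have E1 : (fine (mu E))%:E = (v%:E + mu (E `\` A n))%E.
  rewrite -muE; transitivity (mu (E `\` A n) + mu (E `&` A n))%E.
    exact: measureDI.
  by rewrite EA mu_hit_by addeC.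
have mD : measurable (E `\` A n) by exact: measurableD.
have E2 : mu (E `\` A n) = (fine (mu (E `\` A n)))%:E.
  by rewrite fineK// fin_num_measure.
have E3 : (mu (E `\` A n) + r%:E <= 1)%E.
  rewrite -muA -measureU//; last by rewrite setDE -setIA setICl setI0.
  by apply: probability_le1; exact: measurableU.
have E4 : 0 <= fine (mu (E `\` A n)) by apply: fine_ge0.
move: E1 E3; rewrite E2 -!EFinD lee_fin => -[->] E3.
by rewrite addrAC subrr add0r ger0_norm// ger0_norm; lra.
Unshelve. all: by end_near. Qed.

End law.

(** * The vectors [U] as crossing counts *)

Lemma T1_first_hit (X : traj) m : X 0%N = 0 -> first_hit 1 X m -> T1 X = m.
Proof.
move=> X0 [Xm Xl _]; rewrite /T1; case: pselect => [h|].
  case: ex_minnP => n /andP[n0 Xn] nmin.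
  apply/eqP; rewrite eqn_leq; apply/andP; split.
    by apply: nmin; case: m Xm {Xl} => [|m Xm]; [rewrite X0|rewrite /=; lia].
  by rewrite leqNgt; apply/negP => /Xl; lia.
by case; exists m; case: m Xm {Xl} => [|m Xm]; [rewrite X0|rewrite /=; lia].
Qed.

Lemma T1_posE (X : traj) N : (0 < N)%N ->
  T1 X = N <-> 0 < X N /\ forall l, (0 < l < N)%N -> X l <= 0.
Proof.
move=> N0; rewrite /T1; case: pselect => [h|h].
  case: ex_minnP => n /andP[n0 Xn] nmin; split.
    move=> <-; split => // l /andP[l0 ln]; rewrite leNgt; apply/negP => Xl.
    by have := nmin l; rewrite l0 Xl => /(_ isT); lia.
  move=> [XN Xl]; apply/eqP; rewrite eqn_leq nmin ?N0//= leqNgt.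
  by apply/negP => nN; have := Xl n; rewrite n0 nN => /(_ isT); lia.
split; first by move=> N0'; rewrite -N0' in N0.
by move=> [XN _]; exfalso; apply: h; exists N; rewrite N0.
Qed.

Lemma measurable_T1 N : measurable [set X | T1 X = N].
Proof.
have pos n : (0 < n)%N -> measurable [set X | T1 X = n].
  move=> n0; apply: (@measurable_prefix n) => X Y XY /= /(T1_posE _ n0)[Xn Xl].
  apply/T1_posE => //; rewrite -XY//; split => // l ln.
  by rewrite -XY ?Xl//; case/andP: ln => _ /ltnW.
case: N => [|N]; last exact: pos.
rewrite (_ : [set _ | _] = ~` \bigcup_n [set X | T1 X = n.+1]).
  by apply: measurableC; apply: bigcupT_measurable => n; exact: pos.
apply/seteqP; split => X /=; first by move=> T0 [n _ /=]; rewrite T0.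
by move=> h; case E : (T1 X) => [//|n]; case: h; exists n.
Qed.

Lemma measurable_crosses_back i n a b : measurable [set X | crosses_back X i n a b].
Proof.
rewrite (_ : [set _ | _] = \bigcup_m [set X : traj | (n < m)%N /\
  [/\ X n = i, X n.+1 = i - 1 & [/\ forall l, (n < l <= m)%N -> X l < i,
      i <= X m.+1, X m = a & X m.+1 = b]]]); last first.
  apply/seteqP; split => X.
    by move=> [h1 h2 [m [h3 h4 h5 h6 h7]]]; exists m.
  by move=> [m _ [h3 [h1 h2 [h4 h5 h6 h7]]]]; split => //; exists m.
apply: bigcupT_measurable => m; apply: (@measurable_prefix m.+1) => X Y XY.
move=> [nm [h1 h2 [h3 h4 h5 h6]]]; split => //.
have nm1 : (n <= m.+1)%N by lia.
rewrite -!XY//; last exact: ltnW; split => //; split => // l /andP[nl lm].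
by rewrite -XY ?h3 ?nl//; exact: leqW.
Qed.

Lemma measurable_count (N k : nat) (P : nat -> set traj) :
  (forall n, measurable (P n)) ->
  measurable [set X | (\sum_(n < N) `[< P n X >])%N = k].
Proof.
move=> mP; elim: N k => [|N IH] k.
  have E : [set X | (\sum_(n < 0) `[< P n X >])%N = k] = [set X | 0%N = k].
    by apply/seteqP; split => X /=; rewrite big_ord0.
  rewrite E; case: k {E} => [|k].
    by rewrite (_ : [set _ | _] = setT)//; apply/seteqP; split.
  by rewrite (_ : [set _ | _] = set0)//; apply/seteqP; split.
rewrite (_ : [set _ | _] = (P N `&` [set X | (\sum_(n < N) `[< P n X >]).+1 = k]%N)
   `|` (~` P N `&` [set X | (\sum_(n < N) `[< P n X >]) = k]%N)).
  apply: measurableU; apply: measurableI => //; last exact: measurableC.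
  case: k => [|k]; first by rewrite (_ : [set _ | _] = set0)//; apply/seteqP; split.
  rewrite (_ : [set _ | _] = [set X | (\sum_(n < N) `[< P n X >])%N = k])//.
  by apply/seteqP; split => X /=; [move=> []|move=> ->].
apply/seteqP; split => X /=; rewrite big_ord_recr /=.
  by case: asboolP => h; rewrite ?addn1 ?addn0 => e; [left|right].
by move=> [[h <-]|[h <-]]; [rewrite asboolT// addn1|rewrite asboolF// addn0].
Qed.

(** [U] with the ladder time frozen at [N], so that the sums have a deterministic range on each
    event [T1 X = N]. *)
Definition U_until N (X : traj) i : vec :=
  if i == 1 then
    let jump := (X N.-1, X N) in
    if jump == (0, 1) then (1, 0, 0)%N
    else if jump == (-1, 1) then (0, 1, 0)%N
    else if jump == (0, 2) then (0, 0, 1)%N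
    else (0, 0, 0)%N
  else ((\sum_(n < N) `[< crosses_back X i n (i - 1) i >])%N,
        (\sum_(n < N) `[< crosses_back X i n (i - 2) i >])%N,
        (\sum_(n < N) `[< crosses_back X i n (i - 1) (i + 1) >])%N).

Lemma measurable_U i v : measurable [set X | U X i = v].
Proof.
rewrite (_ : [set _ | _] =
    \bigcup_N ([set X | T1 X = N] `&` [set X | U_until N X i = v])); last first.
  apply/seteqP; split => X; first by move=> /= <-; exists (T1 X).
  by move=> [N _ [/= <- <-]].
apply: bigcupT_measurable => N; apply: measurableI; first exact: measurable_T1.
rewrite /U_until; case: eqP => [_|_].
  apply: (@measurable_prefix N) => X Y XY /=.
  by rewrite !XY// leq_pred.
case: v => -[x y] z.
have mc a b k := @measurable_count N k _ (fun n => @measurable_crosses_back i n a b).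
rewrite (_ : [set _ | _] =
   [set X | (\sum_(n < N) `[< crosses_back X i n (i - 1)%R i >])%N = x] `&`
   [set X | (\sum_(n < N) `[< crosses_back X i n (i - 2)%R i >])%N = y] `&`
   [set X | (\sum_(n < N) `[< crosses_back X i n (i - 1)%R (i + 1)%R >])%N = z]).
  by apply: measurableI; [apply: measurableI|]; exact: mc.
by apply/seteqP; split => X /=; [move=> [-> -> ->]|move=> [[-> ->] ->]].
Qed.

Lemma sum_asbool_unique N (P : nat -> bool) :
  (forall l l', (l < N)%N -> (l' < N)%N -> P l -> P l' -> l = l') ->
  (\sum_(l < N) P l)%N = `[< exists2 l, (l < N)%N & P l >].
Proof.
move=> un; case: asboolP => [[l lN Pl]|h].
  rewrite (bigD1 (Ordinal lN))//= Pl big1// => j jl; apply/eqP.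
  rewrite eqb0; apply: contra jl => Pj; apply/eqP/val_inj => /=.
  exact: un Pj Pl.
by rewrite big1// => l _; apply/eqP; rewrite eqb0; apply/negP => Pl; apply: h; exists l.
Qed.

(* The step at time [n] is undone by the crossing at time [l]. *)
Definition matched (X : traj) (i : int) (n l : nat) := [&& X n == i,
  X n.+1 == i - 1, (n < l)%N, `[< forall k, (n < k <= l)%N -> X k < i >] & i <= X l.+1].

Lemma matchedP X i n l : reflect [/\ X n = i, X n.+1 = i - 1, (n < l)%N,
   forall k, (n < k <= l)%N -> X k < i & i <= X l.+1] (matched X i n l).
Proof.
apply: (iffP and5P) => -[h1 h2 h3 h4 h5]; split => //; try exact/eqP.
  exact/asboolP.
exact/asboolP.
Qed.

Definition jumps (X : traj) m (a b : int) : nat :=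
  (\sum_(l < m) ((X l == a) && (X l.+1 == b)))%N.

(** Double counting of matched pairs: a step down from [i] has at most one crossing that undoes it,
    and each upward crossing of [i] undoes exactly one such step. *)
Lemma cross_countE (X : traj) m (i a b : int) : X 0%N = 0 -> first_hit 1 X m ->
  i <= 0 -> a < i -> i <= b ->
  cross_count X i a b = jumps X m a b.
Proof.
move=> X0 hm i0 ai ib; rewrite /cross_count (T1_first_hit X0 hm).
have [Xm Xl Xj] := hm.
transitivity (\sum_(n < m) \sum_(l < m)
    (matched X i n l && ((X l == a) && (X l.+1 == b))))%N.
  apply: eq_bigr => n _; rewrite (sum_asbool_unique (P := fun l =>
     matched X i n l && ((X l == a) && (X l.+1 == b)))); last first.
    move=> l l' _ _ /andP[/matchedP[_ _ nl h h'] _] /andP[/matchedP[_ _ nl' k k'] _].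
    case: (ltngtP l l') => // ll.
      by have := k l.+1; rewrite ll ltnS (ltnW nl) => /(_ isT); lia.
    by have := h l'.+1; rewrite ll ltnS (ltnW nl') => /(_ isT); lia.
  congr (nat_of_bool _); apply: asbool_equiv_eq; split.
    move=> [h1 h2 [l [h3 h4 h5 h6 h7]]]; exists l; last first.
      by apply/andP; split; [apply/matchedP|rewrite h6 h7 !eqxx].
    by rewrite ltnNge; apply/negP => ml; have := h4 m; rewrite ml ltn_ord => /(_ isT); lia.
  move=> [l lm /andP[/matchedP[h1 h2 h3 h4 h5] /andP[/eqP h6 /eqP h7]]].
  by split => //; exists l.
rewrite exchange_big /=; apply: eq_bigr => l _.
case: (boolP ((X l == a) && (X l.+1 == b))) => [/andP[/eqP Xa /eqP Xb]|_]; last first.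
  by rewrite big1// => n _; rewrite andbF.
under eq_bigr do rewrite andbT.
rewrite (sum_asbool_unique (P := fun n => matched X i n l)); last first.
  move=> n n' _ _ /matchedP[h1 h2 h3 h4 h5] /matchedP[k1 k2 k3 k4 k5].
  case: (ltngtP n n') => // nn.
    by have := h4 n'; rewrite nn (ltnW k3) => /(_ isT); lia.
  by have := k4 n; rewrite nn (ltnW h3) => /(_ isT); lia.
rewrite asboolT//.
(* The matching step leaves at the last time up to [l] spent at or above [i]. Such a time exists
   because [X 0 = 0] and [i <= 0]; since legal downward jumps have size 1, the step goes from [i] to
   [i - 1]. *)
have ex : exists n, (n <= l)%N && (i <= X n) by exists 0%N; rewrite X0.
have ub n : (n <= l)%N && (i <= X n) -> (n <= l)%N by case/andP.
case: (ex_maxnP ex ub) => n /andP[nl Xn] nmax.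
have nl' : (n < l)%N.
  by rewrite ltn_neqAle nl andbT; apply: contraTneq Xn => ->; rewrite Xa -ltNge.
have below k : (n < k <= l)%N -> X k < i.
  move=> /andP[nk kl]; rewrite ltNge; apply/negP => Xk.
  by have := nmax k; rewrite kl Xk => /(_ isT); lia.
have nm : (n < m)%N := ltn_trans nl' (ltn_ord l).
exists n => //; apply/matchedP.
have Xn1 : X n.+1 < i by apply: below; rewrite ltnSn nl'.
have := Xj n nm; rewrite /is_jump => jn.
by split => //; [lia|lia|rewrite Xb].
Qed.

Lemma runE (X : traj) m (j : int) : (forall l, (l < m)%N -> is_jump (X l.+1 - X l)) ->
  run state0 X m j =
  (jumps X m (j - 1) j, jumps X m (j - 2) j, jumps X m (j - 1) (j + 1)).
Proof.
rewrite /jumps; elim: m => [|m IH] Xj; first by rewrite !big_ord0.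
rewrite !big_ord_recr /=; have := Xj m (ltnSn _).
set x := X m; set y := X m.+1; rewrite /step_state /is_jump.
have {}IH := IH (fun l lm => Xj l (ltnW lm)).
have [y1|y1] := eqVneq y (x + 1).
  move=> _; rewrite /up1 IH.
  have -> : (x == j - 2) && (y == j) = false by lia.
  have -> : (x == j - 1) && (y == j + 1) = false by lia.
  have -> : (x == j - 1) && (y == j) = (j == x + 1) by lia.
  by case: ifP => _; rewrite /add1 /= ?addn0 ?addn1.
have [y2|y2] := eqVneq y (x + 2).
  move=> _; rewrite /up2 IH.
  have -> : (x == j - 2) && (y == j) = (j == x + 2) by lia.
  have -> : (x == j - 1) && (y == j + 1) = (j == x + 1) by lia.
  have -> : (x == j - 1) && (y == j) = false by lia.
  case: ifP => [/eqP ->|_].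
    have -> : (x + 1 == x + 2) = false by lia.
    by rewrite /add3 /= ?addn0 ?addn1.
  by case: ifP => _; rewrite /add2 /= ?addn0 ?addn1.
move=> yx; rewrite IH.
have -> : (x == j - 2) && (y == j) = false by lia.
have -> : (x == j - 1) && (y == j + 1) = false by lia.
have -> : (x == j - 1) && (y == j) = false by lia.
by rewrite !addn0.
Qed.

Lemma U_run (X : traj) m (j : int) : X 0%N = 0 -> first_hit 1 X m -> j <= 1 ->
  U X j = run state0 X m j.
Proof.
move=> X0 hm j1; have [Xm Xl Xj] := hm; rewrite (runE _ Xj) /U.
have [->|jn1] := eqVneq j 1; last first.
  have j0 : j <= 0 by lia.
  by rewrite !(cross_countE X0 hm j0)//; lia.
rewrite (T1_first_hit X0 hm).
case: m hm Xm Xl Xj => [|m] hm Xm Xl Xj; first by rewrite X0 in Xm.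
(* Only the final jump lands at 1 or above, so the crossing counts at level 1 reduce to the
   convention defining the immigrant. *)
have last_only a b : 1 <= b -> jumps X m.+1 a b = (X m == a) && (X m.+1 == b).
  move=> b1; rewrite /jumps big_ord_recr /= big1// => l _; apply/eqP; rewrite eqb0.
  by apply/negP => /andP[_ /eqP]; have := Xl l.+1 (ltn_ord l); lia.
have := Xj m (ltnSn _); have Xm0 := Xl m (ltnSn _).
rewrite !last_only//.
move: Xm Xm0 => /=; rewrite /is_jump !xpair_eqE.
move: (X m) (X m.+1) => x y y1 x1 jmp.
have [[-> ->]|[[-> ->]|[-> ->]]] :
  (x = 0 /\ y = 1) \/ (x = -1 /\ y = 1) \/ (x = 0 /\ y = 2) by lia.
- by [].
- by [].
- by [].
Qed.

(** * Almost every environment is transient and nondegenerate at all sites *)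

(* [f] need not be measurable: its integral is a supremum over simple functions. *)
Lemma ae_eq1_of_integral d (T : measurableType d) (R : realType)
    (P : probability T R) (f : T -> \bar R) :
  (forall x, 0 <= f x <= 1)%E -> (\int[P]_x f x = 1)%E ->
  {ae P, forall x, f x = 1%E}.
Proof.
move=> f01 If.
have hP (n : nat) : exists h : {nnsfun T >-> R},
    (forall x, (h x)%:E <= f x)%E /\ ((1 - n.+1%:R^-1)%:E < \int[P]_x (h x)%:E)%E.
  have : ((1 - n.+1%:R^-1)%:E < \int[P]_x f x)%E.
    by rewrite If lte_fin ltrBlDr ltrDl invr_gt0.
  rewrite ge0_integralTE => [|x]; last by have /andP[] := f01 x.
  move=> /ereal_sup_gt[_ [h hf <-] nh]; exists h; split => //.
  by rewrite integralT_nnsfun.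
pose h n := sval (cid (hP n)).
pose F n k := [set x | h n x <= 1 - (k.+1%:R)^-1].
have mF n k : measurable (F n k).
  rewrite (_ : F n k = setT `&` h n @^-1` [set r | r <= 1 - (k.+1%:R)^-1]).
    have mh : measurable_fun setT (h n) by exact: measurable_funPT.
    by apply: mh => //; rewrite -set_itvNyc; exact: measurable_itv.
  by apply/seteqP; split => x // -[].
(* Markov's inequality for [1 - h n], whose integral is below [1 / (n + 1)], on the set where it is
   at least [1 / (k + 1)]. Letting [n] grow makes the intersection over [n] null. *)
have PF n k : (P (F n k) <= ((k.+1%:R) / n.+1%:R)%:E)%E.
  have [hf hI] := svalP (cid (hP n)); rewrite -/(h n) in hf hI.
  have k0 : 0 < (k.+1%:R : R)^-1 by rewrite invr_gt0.
  pose f1 x : \bar R := (h n x)%:E.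
  pose f2 x : \bar R := (\1_(F n k) x)%:E.
  have m1 : measurable_fun setT f1 by apply/measurable_EFinP; exact: measurable_funPT.
  have m2 : measurable_fun setT f2 by apply/measurable_EFinP; exact: measurable_indic.
  have f20 x : setT x -> (0 <= f2 x)%E by move=> _; rewrite lee_fin.
  have f20' x : setT x -> (0 <= (k.+1%:R^-1)%:E * f2 x)%E.
    by move=> _; rewrite mule_ge0 ?f20// lee_fin ltW.
  have m2' : measurable_fun setT (fun x => (k.+1%:R^-1)%:E * f2 x)%E.
    by apply: emeasurable_funM.
  have I1 : (\int[P]_x (f1 x + (k.+1%:R^-1)%:E * f2 x) <= 1)%E.
    rewrite -[leRHS](_ : (\int[P]_x (cst 1%:E x) = 1)%E); last first.
      by rewrite integral_cst// mul1e; exact: probability_setT.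
    apply: ge0_le_integral => //.
    - by move=> x _; rewrite adde_ge0// ?f20'// lee_fin.
    - exact: emeasurable_funD.
    - move=> x _; rewrite /f1 /f2 -EFinM -EFinD lee_fin indicE.
      have h1 : h n x <= 1.
        by have /andP[_] := f01 x; move/(le_trans (hf x)); rewrite lee_fin.
      case: (boolP (x \in F n k)) => [|_]; last by rewrite mulr0 addr0.
      by rewrite inE /F /= mulr1 lerBrDr.
  have f10 x : setT x -> (0 <= f1 x)%E by move=> _; rewrite lee_fin.
  rewrite (ge0_integralD P measurableT f10 m1 f20' m2') in I1.
  rewrite (ge0_integralZl_EFin P measurableT f20 m2 (ltW k0)) in I1.
  rewrite integral_indic// setIT in I1.
  have PE : P (F n k) = (fine (P (F n k)))%:E by rewrite fineK// fin_num_measure.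
  have : ((1 - n.+1%:R^-1)%:E + (k.+1%:R^-1)%:E * P (F n k) <= 1)%E.
    by apply: le_trans I1; rewrite leeD2r// ltW.
  rewrite PE -EFinM -EFinD !lee_fin => e.
  rewrite -(ler_pdivrMl _ _ (ltr0Sn R k)).
  by move: e; rewrite -lerBrDl opprB addrCA subrr addr0.
apply: (@negligibleS _ _ _ _ (\bigcup_k \bigcap_n F n k)).
  move=> x /= fx; have /andP[f0 f1] := f01 x.
  have {fx} f1' : (f x < 1)%E by rewrite lt_neqAle f1 andbT; apply/eqP.
  have fE : f x = (fine (f x))%:E.
    by rewrite fineK// ge0_fin_numE// (lt_trans f1')// ltry.
  have e0 : 0 < 1 - fine (f x) by move: f1'; rewrite fE lte_fin; lra.
  have [k] := ltr_add_invr (y := 0) (x := 1 - fine (f x)) e0.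
  rewrite add0r => kf; exists k => // n _; rewrite /F /=.
  have [/(_ x) hf _] := svalP (cid (hP n)).
  move: hf; rewrite -/(h n) fE lee_fin => /le_trans; apply.
  by rewrite lerBrDr -lerBrDl ltW.
apply: negligible_bigcup => k.
have mI : measurable (\bigcap_n F n k) by apply: bigcap_measurableType.
apply/negligibleP => //; apply/eqP; rewrite eq_le measure_ge0 andbT.
apply/lee_addgt0Pr => e e0; rewrite add0e.
have [n] := ltr_add_invr (y := 0) (x := e / k.+1%:R) (divr_gt0 e0 (ltr0Sn _ _)).
rewrite add0r => ne; apply: le_trans (le_trans (PF n k) _).
  by apply: le_measure; rewrite ?inE// => x; apply.
by rewrite lee_fin mulrC -ler_pdivlMr// ltW.
Qed.

(** * Stationarity at every site *)

Section shifts.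
Variable R : realType.

Definition shift_by (k : int) (w : env R) : env R := fun n => w (n + k).

Lemma measurable_shift_by k (F : set (env R)) :
  measurable F -> measurable (shift_by k @^-1` F).
Proof.
have m : @measurable_fun _ _ (env R) (env R) setT (shift_by k).
  apply: (@measurability _ _ (env R) (env R) _ _ (@env_cylinders R)) => //.
  move=> _ [_ [x [z [B mB ->]]] <-]; rewrite setTI.
  by apply: sub_sigma_algebra; exists (x + k), z, B.
by move=> mF; rewrite -[X in measurable X]setTI; exact: m.
Qed.

Variable P : probability (env R) R.
Hypothesis Pstat : stationary P.

Lemma stationary_shift_by k F : measurable F -> P (shift_by k @^-1` F) = P F.
Proof.
move=> mF.
have nat_shift (n : nat) G : measurable G -> P (shift_by n%:Z @^-1` G) = P G.
  move=> mG; elim: n => [|n IH].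
    rewrite (_ : _ @^-1` _ = G)//; apply/seteqP; split => w;
    by rewrite /preimage /= (_ : shift_by 0 w = w)//;
      apply/funext => i; rewrite /shift_by addr0.
  rewrite -IH -(Pstat (measurable_shift_by n mG)).
  congr (P _); apply/seteqP; split => w; rewrite /preimage /=;
  by rewrite (_ : shift_by n.+1 w = shift_by n (Defs.shift w))//;
    apply/funext => i; rewrite /shift_by /Defs.shift; congr w; lia.
case: k => n; first exact: nat_shift.
(* A negative shift is cancelled by the opposite positive one, whose invariance is already known. *)
rewrite -(nat_shift n.+1 _ (measurable_shift_by _ mF)).
congr (P _); apply/seteqP; split => w; rewrite /preimage /=;
by rewrite (_ : shift_by _ (shift_by _ w) = w)//;
  apply/funext => i; rewrite /shift_by; congr w; lia.
Qed.

Lemma ae_shift_by (Q : env R -> Prop) : {ae P, forall w, Q w} ->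
  {ae P, forall w, forall k, Q (shift_by k w)}.
Proof.
move=> [N [mN PN QN]].
pose G (n : nat) := shift_by n%:Z @^-1` N `|` shift_by (- n%:Z) @^-1` N.
apply: (@negligibleS _ _ _ _ (\bigcup_n G n)).
  move=> w /= /existsNP[k] Qk; exists `|k|%N => //.
  have [k0|k0] := lerP 0 k; [left|right]; apply: QN => /=.
    by have <- : k = `|k|%N%:Z by lia.
  by have <- : k = - `|k|%N%:Z by lia.
apply: negligible_bigcup => n.
have neg k : P.-negligible (shift_by k @^-1` N).
  apply/(negligibleP _ (measurable_shift_by k mN)).
  by rewrite -PN; apply: stationary_shift_by.
by apply: negligibleU.
Qed.

End shifts.

(** * Transience from every starting point *)

Definition reach M n : set traj := [set X | exists2 m, (m <= n)%N & M <= X m].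

Lemma prefix_reach M n : prefix_event n (reach M n).
Proof. by move=> X Y XY [m mn Xm]; exists m; rewrite -?XY. Qed.

Lemma tends_to_inftyP (R : realType) (X : traj) : tends_to_infty R X <->
  forall k : nat, exists N : nat, forall n, (N <= n)%N -> k%:Z <= X n.
Proof.
split.
  move=> /cvgryPge h k; have [N _ Nk] := h k%:R; exists N => n Nn.
  by have := Nk n Nn; rewrite /= -[k%:R]/((k%:Z)%:~R) ler_int.
move=> h; apply/cvgryPge => A; have [N Nk] := h (Num.bound `|A|).
exists N => // n /= /Nk; rewrite -(ler_int R) => /(le_trans _); apply.
by apply: le_trans (ler_norm _) _; apply/ltW/archi_boundP.
Qed.

Lemma measurable_tends_to_infty (R : realType) :
  measurable [set X : traj | tends_to_infty R X].
Proof.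
rewrite (_ : [set _ | _] = \bigcap_(k : nat) \bigcup_(N : nat) \bigcap_(n : nat)
   [set X : traj | (N <= n)%N -> k%:Z <= X n]).
  apply: bigcap_measurableType => k _; apply: bigcupT_measurable => N.
  apply: bigcap_measurableType => n _; apply: (@measurable_prefix n) => X Y XY /=.
  by rewrite XY.
apply/seteqP; split => X /=.
  by move=> /tends_to_inftyP h k _; have [N Nk] := h k; exists N => // n _ /=; exact: Nk.
move=> h; apply/tends_to_inftyP => k; have [N _ Nk] := h k I.
by exists N => n; exact: Nk.
Qed.

Section transience.
Variables (R : realType) (w : env R).

Lemma eq_psum_jumps n x (D D' : set traj) : (forall X : traj, X 0%N = x ->
    (forall l, (l < n)%N -> is_jump (X l.+1 - X l)) -> D X <-> D' X) ->
  psum w n x D = psum w n x D'.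
Proof.
elim: n x D D' => [|n IH] x D D' DD /=.
  by congr (nat_of_bool _)%:R; apply: asbool_equiv_eq; exact: DD.
have step z : is_jump z -> psum w n (x + z) [set X | D (scons x X)] =
    psum w n (x + z) [set X | D' (scons x X)].
  move=> jz; apply: IH => X X0 Xj; apply: DD => // -[|l] lm; last exact: Xj.
  by rewrite /= X0 addrAC subrr add0r.
by rewrite !step.
Qed.

Lemma psum_reach M n x :
  psum w n x (reach M n) = value w M n (fun _ _ => 1) x state0.
Proof.
transitivity (psum w n x (hit_by M n (fun _ _ => True) state0)); last first.
  by rewrite psum_hit; apply: value_eq => *; rewrite asboolT.
apply: eq_psum_jumps => X _ Xj; split; last by move=> [m mn [[Xm _ _] _]]; exists m.
move=> [m mn Xm].
have ex : exists m, M <= X m by exists m.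
case: (ex_minnP ex) => l Xl lmin; have lm := lmin _ Xm.
exists l; first exact: leq_trans mn.
split => //; split => // j jl; last by apply: Xj; lia.
by rewrite ltNge; apply/negP => /lmin; lia.
Qed.

Lemma value1_cvg (mu : probability traj R) M : walk_law w 0 mu ->
  mu [set X | tends_to_infty R X] = 1%E ->
  value w M n (fun _ _ => 1) 0 state0 @[n --> \oo] --> (1 : R).
Proof.
move=> [mu0 muS] mutends.
pose A n := [set X : traj | X 0%N = 0] `&` reach M n.
have mA n : measurable (A n).
  apply: measurableI; first exact: measurable_coordinate.
  exact: measurable_prefix (@prefix_reach M n).
have muA n : mu (A n) = (value w M n (fun _ _ => 1) 0 state0)%:E.
  by rewrite (mu_prefix muS mu0 (@prefix_reach M n)) psum_reach.
have mU : measurable (\bigcup_n A n) by exact: bigcupT_measurable.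
have m0 : measurable [set X : traj | X 0%N = 0] by exact: measurable_coordinate.
have muU : mu (\bigcup_n A n) = 1%E.
  apply/eqP; rewrite eq_le probability_le1//=.
  have := probability_setC mu m0; rewrite mu0 subee// => muC.
  have mT := measurable_tends_to_infty R.
  have : (mu [set X | tends_to_infty R X] <=
      mu (\bigcup_n A n `|` ~` [set X : traj | X 0%N = 0%R]))%E.
    apply: le_measure; rewrite ?inE//; first by apply: measurableU => //; exact: measurableC.
    move=> X /tends_to_inftyP h; have [X0|X0] := eqVneq (X 0%N) 0; last first.
      by right; apply/eqP.
    left; have [N Nk] := h `|M|%N; exists N => //; split => //.
    by exists N => //; have := Nk N (leqnn _); lia.
  rewrite mutends => /le_trans; apply.
  apply: le_trans (measureU2 _ mU (measurableC m0)) _.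
  by rewrite [X in (_ + X)%E]muC adde0.
have ndA : nondecreasing_seq A.
  apply/nondecreasing_seqP => n; apply/subsetPset => X [X0 [m mn Xm]].
  by split => //; exists m => //; exact: leqW.
have h : mu (A n) @[n --> \oo] --> (1 : R)%:E.
  by rewrite -muU; exact: nondecreasing_cvg_mu.
have /fine_cvgP[_] := h.
rewrite (_ : _ \o _ = fun n => value w M n (fun _ _ => 1) 0 state0)//.
by apply/funext => n /=; rewrite muA.
Qed.

Lemma value1_shift_by k M n x :
  value (shift_by k w) M n (fun _ _ => 1) x state0 =
  value w (M + k) n (fun _ _ => 1) (x + k) state0.
Proof.
elim: n x => [|n IH] x /=; rewrite lerD2r//.
by case: ifP => // _; rewrite !(value1_state _ _ _ _ (up1 _ _)) !(value1_state _ _ _ _ (up2 _ _))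
   !IH (addrAC x) (addrAC x 1) (addrAC x 2).
Qed.

(** A walk from [x] is a walk from [0] in the environment shifted by [x], with levels lowered by
    [x]. *)
Lemma hits_every_level_shift : (forall k M,
    value (shift_by k w) M n (fun _ _ => 1) 0 state0 @[n --> \oo] --> (1 : R)) ->
  hits_every_level w.
Proof.
move=> h M x; have := h x (M - x).
by under eq_fun do rewrite value1_shift_by subrK add0r.
Qed.

End transience.

Definition good_env (R : realType) (w : env R) :=
  hits_every_level w /\ forall i, q w i < 1.

Lemma ae_good_env (R : realType) (P : probability (env R) R)
    (Pw : env R -> int -> probability traj R) :
  (forall w k, walk_law w k (Pw w k)) -> stationary P -> elliptic P ->
  annealed P Pw [set wX | tends_to_infty R wX.2] = 1%E ->
  {ae P, forall w, good_env w}.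
Proof.
move=> Pw_walk Pstat [eps eps0 Pell] Pinf.
have : {ae P, forall w, Pw w 0 [set X | tends_to_infty R X] = 1%E}.
  apply: ae_eq1_of_integral => [w|].
    rewrite measure_ge0/= probability_le1//; exact: measurable_tends_to_infty.
  rewrite -[RHS]Pinf /annealed; apply: eq_integral => w _; congr (Pw w 0 _).
  by apply/seteqP; split => X; rewrite /xsection /= inE.
move=> /(ae_shift_by Pstat) tr; move: Pell => /(ae_shift_by Pstat) ell.
apply: filterS2 tr ell => w tr ell; split.
  apply: hits_every_level_shift => k M; apply: value1_cvg (Pw_walk _ 0) _.
  exact: tr.
move=> i; have [] := ell i; rewrite /q /p1 /p2 /shift_by add0r.
have := qP w i; rewrite /q /p1 /p2 => -[q0 p0 p0' qE] e1 e2.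
(* If [q] were 1, then [p1] would vanish, against the lower bound [eps * q]. *)
by rewrite ltNge; apply/negP => q1; have : eps <= eps * jq (w i); nra.
Qed.

(** * The law of [U] in a fixed environment *)

Section environment.
Variables (R : realType) (Pw : env R -> int -> probability traj R) (w : env R).
Hypothesis Pw_walk : forall k, walk_law w k (Pw w k).
Hypothesis good : good_env w.
Implicit Types (L i : int) (s t : state) (u v : vec).

Let tr : hits_every_level w := good.1.

Local Notation a_ i := (step_enter w i (add1 vec0)).
Local Notation b_ i := (step_enter w i (add2 vec0)).
Local Notation g_ i := (step_enter w i (add3 vec0)).

(** The three entrance types share the mass [q w i] of the step down, which is below 1. *)
Lemma no_return_gt0 i : 0 < 1 - a_ i - b_ i.
Proof.
have := step_enter_sum tr i; have := step_enter_ge0 w i (add3 vec0).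
by have [_ qi] := good; have := qi i; have [_ _ _] := qP w i; lra.
Qed.

Lemma exit_probE L (j : int) : 0 <= j -> exit_prob Pw w (L - 1) (j + 1) =
  (enter w L (add1 vec0) (L - 1) + enter w L (add2 vec0) (L - 1)) * (j == 0)%:R
  + enter w L (add3 vec0) (L - 1) * (j == 1)%:R.
Proof.
move=> j0; rewrite /exit_prob -vlim_exit_point.
set E : set traj := [set X | _].
have mE : measurable E.
  rewrite (_ : E = \bigcup_n [set X : traj | X n = L - 1 + (j + 1) /\
      forall m, (m < n)%N -> X m < L - 1 + 1]).
    apply: bigcupT_measurable => n; apply: (@measurable_prefix n) => X Y XY [Xn Xm].
    by split => [|m mn]; rewrite -XY//; [exact: Xm|exact: ltnW].
  by apply/seteqP; split => X; [move=> [n h]; exists n|move=> [n _ h]; exists n].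
rewrite (@mu_vlim _ w (L - 1) _ (Pw_walk _) tr L E (fun y _ => y = L + j) state0 mE).
  congr (limn _); apply/funext => n; apply: value_eq => y s _ /=.
  by congr (nat_of_bool _)%:R; apply/asboolP/eqP.
move=> X m X0 [Xm Xl _]; rewrite /E /= subrK; split.
  move=> [n [Xn Xln]]; case: (ltngtP m n) => [mn|nm|->].
  - by have := Xln _ mn; lia.
  - by have := Xl _ nm; lia.
  - by rewrite Xn; lia.
by move=> Xmj; exists m; split => //; rewrite Xmj; lia.
Qed.

Lemma gammaE i : gamma Pw w i = g_ i.
Proof.
by rewrite /gamma (exit_probE i (ler01 : 0 <= 1 :> int)) /= mulr0 add0r mulr1.
Qed.

Lemma exit_prob1E i : exit_prob Pw w (i - 1) 1 =
  enter w i (add1 vec0) (i - 1) + enter w i (add2 vec0) (i - 1).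
Proof.
have := exit_probE i (lexx 0 : 0 <= 0 :> int).
by rewrite add0r /= mulr1 mulr0 addr0.
Qed.

(** With [d] the probability of no return, the common factor [d] cancels, so the quotients in
    [alpha] and [beta] split the probability of landing at the level by jump type. *)
Lemma enter_ratio (d x y h1 h2 : R) : 0 < d -> d * h1 = x -> d * h2 = y ->
  0 <= h1 -> 0 <= h2 ->
  (h1 + h2) * (x / (x + y)) = h1 /\ (h1 + h2) * (y / (x + y)) = h2.
Proof.
move=> d0 <- <- h10 h20; rewrite -mulrDr.
(* If neither jump can occur, the quotients are [0 / 0], which is [0] here, and both sides
   vanish. *)
have [h|h] := eqVneq (h1 + h2) 0.
  move: h => /eqP; rewrite paddr_eq0// => /andP[/eqP -> /eqP ->].
  by rewrite !addr0 !mul0r.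
have dn0 : d != 0 by rewrite gt_eqF.
by split; field; rewrite h dn0.
Qed.

Lemma alpha_betaE i : alpha Pw w i = a_ i /\ beta Pw w i = b_ i.
Proof.
rewrite /alpha /beta gammaE exit_prob1E -2!(mulrA (q w i)).
have [] := enter_ratio (no_return_gt0 (i - 1)) (enter1 tr i) (enter2 tr i).
- by have /andP[] := enter01 w i (add1 vec0) (i - 1).
- by have /andP[] := enter01 w i (add2 vec0) (i - 1).
- by move=> -> ->.
Qed.

Definition U_event (D : state -> Prop) : set traj := [set X | D (U X)].

Lemma mu_U_event (D : state -> Prop) :
  (forall s t, (forall j, j <= 1 -> s j = t j) -> D s -> D t) ->
  measurable (U_event D) ->
  Pw w 0 (U_event D) = (vlim w 1 (fun _ s => `[< D s >]%:R) 0 state0)%:E.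
Proof.
move=> D1 mD.
apply: (@mu_vlim _ w 0 _ (Pw_walk _) tr 1 _ (fun _ s => D s) state0 mD).
move=> X m X0 hm; rewrite /U_event /=; split; apply: D1 => j j1;
  by rewrite (U_run X0 hm).
Qed.

Local Notation K i := (offspring (alpha Pw w i) (beta Pw w i)).

(** [D] may involve all generations from level 1 down to [L + 1], so the identity contains the
    Markov property as well as the offspring law. *)
Lemma mu_next_gen L u v (D : state -> Prop) : L <= 0 ->
  (forall s t, (forall j, L + 1 <= j <= 1 -> s j = t j) -> D s -> D t) ->
  (forall s, D s -> s (L + 1) = u) -> measurable (U_event D) ->
  Pw w 0 (U_event D `&` [set X | U X L = v]) = ((K L u v)%:E * Pw w 0 (U_event D))%E.
Proof.
move=> L0 DL Du mD; have [-> ->] := alpha_betaE L.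
rewrite (mu_U_event _ mD); last by move=> s t st; apply: DL => j /andP[_]; exact: st.
rewrite (_ : _ `&` _ = U_event (fun s => D s /\ s L = v)); last first.
  by apply/seteqP; split.
rewrite mu_U_event; last 2 first.
- move=> s t st [Ds sv]; split; last by rewrite -st//; lia.
  by apply: DL Ds => j /andP[_]; exact: st.
- by apply: measurableI => //; exact: measurable_U.
rewrite -EFinM; congr EFin.
pose F s : R := `[< D s >]%:R.
have F01 s : 0 <= F s <= 1 by rewrite /F; case: `[< _ >]; rewrite ?lexx ?ler01.
have FL s t : agree (L + 1) s t -> F s = F t.
  move=> st; congr (nat_of_bool _)%:R; apply: asbool_equiv_eq.
  by split; apply: DL => j /andP[/st].
have L1 : L < 1 by lia.
transitivity (vlim w 1 (fun _ s => F s * (s L == v)%:R) 0 state0).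
  congr (limn _); apply/funext => n; apply: value_eq => _ s _.
  rewrite /F -natrM mulnb; congr (nat_of_bool _)%:R.
  by rewrite asbool_and; congr (_ && _); apply/asboolP/eqP.
(* The ladder time is the entrance into [[1, oo)] from [0]. Afterwards the kernel factors out,
   because the count at [L + 1] equals [u] on [D]. *)
rewrite (@vlim_branching _ w tr 1 L L1 F F01 FL (no_return_gt0 L) v 0 L0).
pose k := offspring (a_ L) (b_ L) u v.
transitivity (vlim w 1 (fun _ s => k * F s + 0 * F s + 0 * F s) 0 state0).
  congr (limn _); apply/funext => n; apply: value_eq => _ s _.
  rewrite !mul0r !addr0 mulrC /F; case: asboolP; last by rewrite !mulr0.
  by move=> /Du ->.
by rewrite vlim_lin ?mul0r ?addr0// => y s _; exact: F01.
Qed.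

Lemma cprob_U L u v (D : state -> Prop) : L <= 0 ->
  (forall s t, (forall j, L + 1 <= j <= 1 -> s j = t j) -> D s -> D t) ->
  (forall s, D s -> s (L + 1) = u) -> measurable (U_event D) ->
  (0 < Pw w 0%R (U_event D))%E ->
  Defs.cprob (Pw w 0) [set X | U X L = v] (U_event D) = K L u v.
Proof.
move=> L0 DL Du mD D0; rewrite /Defs.cprob setIC (mu_next_gen v L0 DL Du mD).
have DE : Pw w 0 (U_event D) = (fine (Pw w 0 (U_event D)))%:E.
  by rewrite fineK// fin_num_measure.
have d0 : 0 < fine (Pw w 0 (U_event D)) by move: D0; rewrite DE lte_fin.
by rewrite {1}DE -EFinM /= mulfK// gt_eqF.
Qed.

Lemma mu_U1 v : Pw w 0 [set X | U X 1 = v] = (enter w 1 v 0)%:E.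
Proof.
rewrite (@mu_U_event (fun s => s 1 = v)); [|by move=> s t st <-; rewrite st|].
  congr (_%:E); congr (limn _); apply/funext => n; apply: value_eq => y s _.
  by rewrite /last_type; congr (nat_of_bool _)%:R; apply/asboolP/eqP.
exact: measurable_U.
Qed.

Lemma mu_U1_types : [/\ 
  Pw w 0 [set X | U X 1 = (1, 0, 0)%N] = (p1 w 0 / (1 - alpha Pw w 0 - beta Pw w 0))%:E,
  Pw w 0 [set X | U X 1 = (0, 1, 0)%N] = (gamma Pw w 0 / (1 - alpha Pw w 0 - beta Pw w 0))%:E &
  Pw w 0 [set X | U X 1 = (0, 0, 1)%N] = (p2 w 0 / (1 - alpha Pw w 0 - beta Pw w 0))%:E].
Proof.
have [-> ->] := alpha_betaE 0; rewrite gammaE.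
have m0 : 1 - a_ 0 - b_ 0 != 0 by rewrite gt_eqF ?no_return_gt0.
have := enter1 tr 1; have := enter2 tr 1; have := enter3 tr 1; rewrite subrr => e3 e2 e1.
split; rewrite mu_U1; congr EFin; apply: (mulfI m0); rewrite mulrCA divff// mulr1.
- exact: e1.
- exact: e2.
- exact: e3.
Qed.

Definition litter1 (i : int) : vec -> R := geom13 (alpha Pw w i) (beta Pw w i).
Definition litter2 (i : int) : vec -> R := geom2 (alpha Pw w i) (beta Pw w i).

Lemma pmf_litter i : Defs.pmf (litter1 i) /\ Defs.pmf (litter2 i).
Proof.
rewrite /litter1 /litter2; have [-> ->] := alpha_betaE i.
have m0 := no_return_gt0 i.
have ab : a_ i + b_ i < 1 by lra.
have h c := pmf_geometric (step_enter_ge0 w i _) (step_enter_ge0 w i _) c ab.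
split; first exact: h.
by rewrite (funext (geom2E _ _)); exact: h.
Qed.

Lemma measurable_history n (z : nat -> vec) :
  measurable (U_event (fun s => forall m, (m <= n)%N -> s (1 - m%:Z) = z m)).
Proof.
rewrite (_ : U_event _ =
    \bigcap_(m in [set m | (m <= n)%N]) [set X | U X (1 - m%:Z) = z m]).
  by apply: bigcap_measurable => [|m _]; [exists 0%N|exact: measurable_U].
by apply/seteqP; split.
Qed.

Lemma U_branching_process : branching_process (Pw w 0) (fun n X => U X (1 - n%:Z))
  (fun n => litter1 (- n%:Z)) (fun n => litter2 (- n%:Z)) (fun n => litter1 (- n%:Z)).
Proof.
split; first by move=> n v; exact: measurable_U.
  by move=> n; have [h1 h2] := pmf_litter (- n%:Z); split.
move=> n z v history history0.
(* Particles of generation [n] live at level [1 - n]; their offspring law is indexed by the level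
   [- n] of the children. *)
have E : 1 - n.+1%:Z = - n%:Z by lia.
rewrite E; apply: (@cprob_U _ (z n) v _ _ _ _ (measurable_history n z) history0).
- by lia.
- by move=> s t st h m mn; rewrite -st ?h//; lia.
- by move=> s h; rewrite -h//; congr s; lia.
Qed.

Lemma cprob_U_single i u v : i <= 0 ->
  (0 < Pw w 0%R [set X | U X (i + 1)%R = u])%E ->
  Defs.cprob (Pw w 0) [set X | U X i = v] [set X | U X (i + 1) = u] = K i u v.
Proof.
move=> i0; apply: (@cprob_U _ u v (fun s => s (i + 1) = u)) => //.
  by move=> s t st <-; rewrite st//; lia.
exact: measurable_U.
Qed.

End environment.

Theorem theorem1p1 (R : realType) (P : probability (env R) R)
    (Pw : env R -> int -> probability traj R)
    (Pw_walk : forall w k, walk_law w k (Pw w k))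
    (P_stationary : stationary P) (P_ergodic : ergodic P)
    (P_elliptic : elliptic P)
    (transient : annealed P Pw [set wX | tends_to_infty R wX.2] = 1%E) :
  {ae P, forall w : env R,
    let al := alpha Pw w in
    let be := beta Pw w in
    let ga := gamma Pw w in
    let U_is (i : int) (v : vec) := [set X : traj | U X i = v] in
    let geom (i : int) (a b : nat) : R :=
      (1 - al i - be i) * 'C((a + b)%N, a)%:R * al i ^+ a * be i ^+ b in
    exists f1 f2 f3 : int -> vec -> R,
    [/\ branching_process (Pw w 0) (fun n X => U X (1 - n%:Z))
          (fun n => f1 (- n%:Z)) (fun n => f2 (- n%:Z)) (fun n => f3 (- n%:Z)),
        [/\ Pw w 0 (U_is 1 (1, 0, 0)%N) = (p1 w 0 / (1 - al 0 - be 0))%:E,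
            Pw w 0 (U_is 1 (0, 1, 0)%N) = (ga 0 / (1 - al 0 - be 0))%:E &
            Pw w 0 (U_is 1 (0, 0, 1)%N) = (p2 w 0 / (1 - al 0 - be 0))%:E],
        forall (i : int) (a b : nat), i <= 0 ->
          [/\ f1 i (a, b, 0%N) = geom i a b,
              f2 i (a, b, 1%N) = geom i a b &
              f3 i (a, b, 0%N) = geom i a b] &
        forall (i : int) (a b : nat), i <= 0 ->
          [/\ (0 < Pw w 0%R (U_is (i + 1)%R (1, 0, 0)%N))%E ->
              cprob (Pw w 0) (U_is i (a, b, 0%N)) (U_is (i + 1) (1, 0, 0)%N)
                = geom i a b,
              (0 < Pw w 0%R (U_is (i + 1)%R (0, 1, 0)%N))%E ->
              cprob (Pw w 0) (U_is i (a, b, 1%N)) (U_is (i + 1) (0, 1, 0)%N)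
                = geom i a b &
              (0 < Pw w 0%R (U_is (i + 1)%R (0, 0, 1)%N))%E ->
              cprob (Pw w 0) (U_is i (a, b, 0%N)) (U_is (i + 1) (0, 0, 1)%N)
                = geom i a b]]}.
Proof.
have gd := ae_good_env Pw_walk P_stationary P_elliptic transient.
apply: filterS gd => w gd.
have walk := Pw_walk w.
exists (litter1 Pw w), (litter2 Pw w), (litter1 Pw w); split.
- exact: U_branching_process.
- exact: mu_U1_types.
- by move=> i a b _; split.
- move=> i a b i0; split => pos; rewrite (cprob_U_single walk gd)//.
  + by rewrite offspring_type1.
  + by rewrite offspring_type2.
  + by rewrite offspring_type3.
Qed.
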